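(* Let $(M,g)$ be an $n$-dimensional complete gradient Ricci soliton with potential function $f$ and soliton constant $\lambda\in\mathbb{R}$, and suppose that its scalar curvature $R$ is constant. Then $R\in\{0,\lambda,2\lambda,\dots,(n-1)\lambda,n\lambda\}$, i.e. $R=k\lambda$ for some integer $k$ with $0\le k\le n$.
   Context: Manifolds are smooth, connected and without boundary. A gradient Ricci soliton is a complete $n$-dimensional Riemannian manifold $(M,g)$ for which there exist a smooth function $f:M\to\mathbb{R}$ (the potential function) and a real number $\lambda$ (the soliton constant) such that $Rc+H_f=\lambda g$, where $Rc$ is the Ricci tensor and $H_f$ is the Hessian of $f$. The scalar curvature $R$ is the trace of $Rc$ with respect to $g$. *)

(* Defs.v *)
(* MathComp-Analysis, over an arbitrary realType.

   Manifolds are topological spaces with a smooth atlas.  Tensor fields are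
   families of component functions, one for each chart, subject to the usual
   transformation law on overlaps; a (smooth) function, metric or curvature
   quantity is expressed on the open image of a chart in R^n.  Points of R^n
   are row vectors. *)
From mathcomp Require Import all_boot all_order all_algebra.
From mathcomp Require Import all_classical all_reals all_analysis.

Set Implicit Arguments.
Unset Strict Implicit.
Unset Printing Implicit Defensive.

Import Order.TTheory GRing.Theory Num.Theory.
Import numFieldNormedType.Exports.

Local Open Scope classical_set_scope.
Local Open Scope ring_scope.

Definition partial (R : realType) (n : nat) (i : 'I_n) (h : 'rV[R]_n -> R) :
  'rV[R]_n -> R := fun x => 'D_(delta_mx 0 i) h x.

(* C^oo on an open set U: h and its iterated partial derivatives of every
   order are (Frechet) differentiable at each point of U. *)
Definition smooth_on (R : realType) (n : nat) (U : set 'rV[R]_n)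
    (h : 'rV[R]_n -> R) : Prop :=
  forall (s : seq 'I_n) (x : 'rV[R]_n), U x ->
    differentiable (foldr (@partial R n) h s) x.

(* [fwd] and [bwd] are total functions; their values outside [dom], [cod] are
   irrelevant. *)
Record chart (R : realType) (n : nat) (M : topologicalType) := Chart {
  dom : set M;
  cod : set 'rV[R]_n;
  fwd : M -> 'rV[R]_n;
  bwd : 'rV[R]_n -> M;
  dom_open : open dom;
  cod_open : open cod;
  fwd_cod : forall p, dom p -> cod (fwd p);
  bwd_dom : forall x, cod x -> dom (bwd x);
  fwdK : forall p, dom p -> bwd (fwd p) = p;
  bwdK : forall x, cod x -> fwd (bwd x) = x;
  fwd_continuous : forall p, dom p -> {for p, continuous fwd};
  bwd_continuous : forall x, cod x -> {for x, continuous bwd}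
}.

Definition transition (R : realType) (n : nat) (M : topologicalType)
    (a b : chart R n M) : 'rV[R]_n -> 'rV[R]_n :=
  fun x => fwd b (bwd a x).

Definition transition_dom (R : realType) (n : nat) (M : topologicalType)
    (a b : chart R n M) : set 'rV[R]_n :=
  [set x | cod a x /\ dom b (bwd a x)].

Record smooth_atlas (R : realType) (n : nat) (M : topologicalType) :=
  SmoothAtlas {
    atlas_index : Type;
    atlas_chart :> atlas_index -> chart R n M;
    atlas_cover : forall p : M, exists i, dom (atlas_chart i) p;
    atlas_smooth : forall (i j : atlas_index) (k : 'I_n),
      smooth_on (transition_dom (atlas_chart i) (atlas_chart j))
        (fun x => transition (atlas_chart i) (atlas_chart j) x 0 k)
  }.

Definition manifold_space (M : topologicalType) : Prop :=
  [/\ [set: M] !=set0, connected [set: M], hausdorff_space M &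
      @second_countable M].

Definition smooth_function (R : realType) (n : nat) (M : topologicalType)
    (A : smooth_atlas R n M) (f : M -> R) : Prop :=
  forall i : atlas_index A, smooth_on (cod (A i)) (f \o bwd (A i)).

(* Entry (a, b) is the derivative of the b-th new coordinate in the direction
   of the a-th old one. *)
Definition transition_jacobian (R : realType) (n : nat) (M : topologicalType)
    (a b : chart R n M) (x : 'rV[R]_n) : 'M[R]_n :=
  \matrix_(r, s) partial r (fun y => transition a b y 0 s) x.

(* [metric i x] is the Gram matrix of the coordinate frame of the chart i at
   the point with coordinates x. *)
Record riemannian_metric (R : realType) (n : nat) (M : topologicalType)
    (A : smooth_atlas R n M) := RiemannianMetric {
  metric :> atlas_index A -> 'rV[R]_n -> 'M[R]_n;
  metric_smooth : forall i a b,
    smooth_on (cod (A i)) (fun x => metric i x a b);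
  metric_sym : forall i x, cod (A i) x -> (metric i x)^T = metric i x;
  metric_pos : forall i x, cod (A i) x ->
    forall v : 'rV[R]_n, v != 0 -> 0 < (v *m metric i x *m v^T) 0 0;
  metric_compat : forall i j x, transition_dom (A i) (A j) x ->
    metric i x = transition_jacobian (A i) (A j) x
                 *m metric j (transition (A i) (A j) x)
                 *m (transition_jacobian (A i) (A j) x)^T
}.

(* In the next five definitions g and h are the components of a metric and of
   a function in one chart. *)

(* Gamma^k_(ij) of the Levi-Civita connection *)
Definition christoffel (R : realType) (n : nat) (g : 'rV[R]_n -> 'M[R]_n)
    (k i j : 'I_n) : 'rV[R]_n -> R := fun x =>
  2^-1 * \sum_(l < n) invmx (g x) k l *
    (partial i (fun y => g y j l) x + partial j (fun y => g y i l) x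
     - partial l (fun y => g y i j) x).

(* The l-th component of
   R(d_i, d_j) d_k = nabla_i nabla_j d_k - nabla_j nabla_i d_k. *)
Definition riemann (R : realType) (n : nat) (g : 'rV[R]_n -> 'M[R]_n)
    (i j k l : 'I_n) (x : 'rV[R]_n) : R :=
  partial i (christoffel g l j k) x - partial j (christoffel g l i k) x
  + \sum_(p < n) (christoffel g p j k x * christoffel g l i p x
                  - christoffel g p i k x * christoffel g l j p x).

(* Ric(Y, Z) = tr (X |-> R(X, Y) Z); round spheres have positive Ric. *)
Definition ricci (R : realType) (n : nat) (g : 'rV[R]_n -> 'M[R]_n)
    (x : 'rV[R]_n) : 'M[R]_n :=
  \matrix_(j, k) \sum_(i < n) riemann g i j k i x.

Definition scalar_curvature (R : realType) (n : nat)
    (g : 'rV[R]_n -> 'M[R]_n) (x : 'rV[R]_n) : R :=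
  \sum_(j < n) \sum_(k < n) invmx (g x) j k * ricci g x j k.

Definition hessian (R : realType) (n : nat) (g : 'rV[R]_n -> 'M[R]_n)
    (h : 'rV[R]_n -> R) (x : 'rV[R]_n) : 'M[R]_n :=
  \matrix_(i, j) (partial i (partial j h) x
                  - \sum_(k < n) christoffel g k i j x * partial k h x).

Definition curve_coord (R : realType) (n : nat) (M : topologicalType)
    (a : chart R n M) (gamma : R -> M) (k : 'I_n) : R -> R :=
  fun t => fwd a (gamma t) 0 k.

(* Geodesics defined for all times.  By continuity gamma stays in dom (A i)
   near t, so the derivatives at t only involve meaningful coordinates. *)
Definition is_geodesic (R : realType) (n : nat) (M : topologicalType)
    (A : smooth_atlas R n M) (g : riemannian_metric A) (gamma : R -> M) :
    Prop :=
  continuous gamma /\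
  forall (i : atlas_index A) (t : R), dom (A i) (gamma t) ->
  forall k : 'I_n,
    [/\ derivable (curve_coord (A i) gamma k) t 1,
        derivable (derive1 (curve_coord (A i) gamma k)) t 1 &
        derive1 (derive1 (curve_coord (A i) gamma k)) t
        + \sum_(a < n) \sum_(b < n)
            christoffel (g i) k a b (fwd (A i) (gamma t))
            * derive1 (curve_coord (A i) gamma a) t
            * derive1 (curve_coord (A i) gamma b) t = 0].

(* Completeness: the exponential map is defined on the whole tangent bundle.
   The vector v is given by its components in the chart i. *)
Definition complete_metric (R : realType) (n : nat) (M : topologicalType)
    (A : smooth_atlas R n M) (g : riemannian_metric A) : Prop :=
  forall (i : atlas_index A) (p : M) (v : 'rV[R]_n), dom (A i) p ->
  exists gamma : R -> M,
    [/\ is_geodesic g gamma, gamma 0 = p &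
        forall k : 'I_n, derive1 (curve_coord (A i) gamma k) 0 = v 0 k].

Definition gradient_ricci_soliton (R : realType) (n : nat)
    (M : topologicalType) (A : smooth_atlas R n M) (g : riemannian_metric A)
    (f : M -> R) (lambda : R) : Prop :=
  [/\ complete_metric g, smooth_function A f &
      forall (i : atlas_index A) (x : 'rV[R]_n), cod (A i) x ->
        ricci (g i) x + hessian (g i) (f \o bwd (A i)) x = lambda *: g i x].

(* The scalar curvature, a function on M, is the constant c: so is its
   expression in every chart. *)
Definition scalar_curvature_constant (R : realType) (n : nat)
    (M : topologicalType) (A : smooth_atlas R n M) (g : riemannian_metric A)
    (c : R) : Prop :=
  forall (i : atlas_index A) (x : 'rV[R]_n), cod (A i) x ->
    scalar_curvature (g i) x = c.

(* Main.v *)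
From HB Require Import structures.
From mathcomp Require Import all_boot all_order all_fingroup all_algebra.
From mathcomp Require Import all_classical all_reals all_analysis.
From mathcomp Require Import ring lra.
Require Import Defs.

Set Implicit Arguments.
Unset Strict Implicit.
Unset Printing Implicit Defensive.

Import Order.TTheory GRing.Theory Num.Theory.
Import numFieldNormedType.Exports.

Local Open Scope classical_set_scope.
Local Open Scope ring_scope.

(** Tracing the soliton equation Rc + H = lambda g gives n lambda - R = tr H,
    where tr is taken with respect to g, so it suffices to find a point where
    the endomorphism H has only the eigenvalues 0 and lambda.

    The first input is the identity Rc(grad f) = 0 ([Ric_gradf]).  The Ricci
    identity for df turns the skew part of the covariant derivative of H into
    the curvature applied to df; by the soliton equation the former is, up to
    sign, the skew part of the derivative of Rc.  Its trace consists of dR and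
    div Rc, and the contracted second Bianchi identity dR = 2 div Rc
    ([partial_scal_divRic]) makes both vanish when R is constant.  The
    identities are proved in arbitrary coordinates, the connection and the
    curvature being families of matrices indexed by coordinate directions, so
    that the index-free part of each proof is matrix algebra.

    Three consequences of Rc(grad f) = 0 are used.
    - Its derivative at a critical point of f reads Rc H = 0 there, that is
      H^2 = lambda H ([critical_Hess]).  If lambda is nonzero, H / lambda is then
      a projection, its trace is a rank, and R = (n - rank H) lambda
      ([critical_point_value]).
    - Its divergence reads tr (Rc H) = 0.  If lambda = 0 then H = - Rc, so the
      norm of Rc vanishes and R = 0 ([steady_scal0]).
    - The gradient of |grad f|^2 is 2 lambda grad f ([partial_energy]).

    It remains to find a critical point when lambda is nonzero
    ([exists_critical_point]); this is where completeness enters.  Suppose there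
    is none, and let gamma be the geodesic whose initial velocity is the gradient
    of f at some point.  The function
    z = |grad f|^2 |gamma'|^2 - <grad f, gamma'>^2 along gamma is nonnegative and
    vanishes at 0.  By the facts above, z' = 2 <grad f, gamma'> Rc(gamma', gamma'),
    and in Rc(gamma', gamma') only the component of gamma' orthogonal to grad f
    contributes, whose squared length is z / |grad f|^2.  Hence |z'| <= K z
    locally, so z = 0 for all times ([gronwall_zero]) and Rc(gamma', gamma') = 0.
    Then (f o gamma)'' = H(gamma', gamma') = lambda |gamma'|^2 is a nonzero
    constant, so (f o gamma)' vanishes somewhere; but z = 0 says that its square
    is |grad f|^2 |gamma'|^2, which never vanishes. *)

(** * Smooth functions on an open set *)

Section Differentiability.
Context {R : realType} {V W : normedModType R}.

(** The derivative is the zero map, and the remainder is eventually zero. *)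
Lemma near0_differentiable (e : V -> W) (x : V) :
  (\forall y \near x, e y = 0) -> differentiable e x.
Proof.
move=> e0.
have c0 : continuous (0 : V -> W) by exact: cst_continuous.
have E : e \o shift x = cst (e x) + (0 : V -> W) +o_ (0 : V) id.
  apply/eqaddoP => _/posnumP[eps].
  have ex0 : e x = 0 by exact: nbhs_singleton e0.
  near=> h; rewrite /= !fctE ex0 /= addr0 subr0.
  suff -> : e (h + x) = 0 by rewrite normr0 mulr_ge0.
  near: h; move: e0; rewrite (near_shift 0 x)/=.
  by apply: filterS => h /=; rewrite subr0.
have d0 : 'd e x = (0 : V -> W) :> (V -> W) by exact/diff_unique.
by apply/diff_locallyP; rewrite d0.
Unshelve. all: by end_near. Qed.

Lemma near_eq_differentiable (f g : V -> W) (x : V) :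
  (\forall y \near x, f y = g y) -> differentiable f x -> differentiable g x.
Proof.
move=> fg df; rewrite -(subrK f g); apply: differentiableD => //.
apply: near0_differentiable; apply: filterS fg => y fgy.
by rewrite !fctE fgy subrr.
Qed.

End Differentiability.

Section Partial.
Context {R : realType} {n : nat}.
Implicit Types (u v h : 'rV[R]_n -> R) (U : set 'rV[R]_n) (x : 'rV[R]_n).

Lemma near_eq_partial i u v x :
  (\forall y \near x, u y = v y) -> partial i u x = partial i v x.
Proof. exact: near_eq_derive. Qed.

Lemma eq_partial i u v x : u =1 v -> partial i u x = partial i v x.
Proof. by move=> /funext ->. Qed.

Lemma partial_cst i (a : R) x : partial i (fun=> a) x = 0.
Proof. exact: derive_cst. Qed.

Lemma partialD i u v x : differentiable u x -> differentiable v x ->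
  partial i (fun y => u y + v y) x = partial i u x + partial i v x.
Proof. by move=> du dv; rewrite /partial deriveD//; exact: diff_derivable. Qed.

Lemma partialN i u x : differentiable u x ->
  partial i (fun y => - u y) x = - partial i u x.
Proof. by move=> du; rewrite /partial deriveN//; exact: diff_derivable. Qed.

Lemma partialM i u v x : differentiable u x -> differentiable v x ->
  partial i (fun y => u y * v y) x = partial i u x * v x + u x * partial i v x.
Proof.
move=> du dv; rewrite /partial deriveM; try exact: diff_derivable.
by rewrite addrC; congr (_ + _); rewrite mulrC.
Qed.

Lemma differentiable_sumf (I : Type) (r : seq I) (u : I -> 'rV[R]_n -> R) x :
  (forall k, differentiable (u k) x) ->
  differentiable (fun y => \sum_(k <- r) u k y) x.
Proof.
move=> du; elim: r => [|k r IH].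
  rewrite (_ : (fun _ => _) = cst 0); first exact: differentiable_cst.
  by apply/funext => y; rewrite big_nil.
rewrite (_ : (fun _ => _) = u k + (fun y => \sum_(k <- r) u k y)).
  exact: differentiableD.
by apply/funext => y; rewrite big_cons.
Qed.

Lemma partial_sum (I : Type) (r : seq I) i (u : I -> 'rV[R]_n -> R) x :
  (forall k, differentiable (u k) x) ->
  partial i (fun y => \sum_(k <- r) u k y) x = \sum_(k <- r) partial i (u k) x.
Proof.
move=> du; elim: r => [|k r IH].
  rewrite big_nil -[RHS](partial_cst i 0 x); apply: eq_partial => y.
  by rewrite big_nil.
rewrite big_cons -IH -partialD //; last exact: differentiable_sumf.
by apply: eq_partial => y; rewrite big_cons.
Qed.

Lemma partialV i u x : differentiable u x -> u x != 0 ->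
  partial i (fun y => (u y)^-1) x = - (u x)^-1 * (u x)^-1 * partial i u x.
Proof.
move=> du ux; rewrite /partial deriveV //; last exact: diff_derivable.
by rewrite mulNr -expr2 exprVn.
Qed.

(** Leibniz and quotient rules express a first derivative of a product or an
    inverse through functions of the same shape, so closure properties of
    smooth functions go by induction on the number of derivatives. *)
Definition C_on k U h := forall (s : seq 'I_n) x,
  (size s <= k)%N -> U x -> differentiable (foldr (@partial R n) h s) x.

Lemma smooth_onP U h : smooth_on U h <-> forall k, C_on k U h.
Proof.
by split=> [sh k s x _ /sh|ch s x Ux]; [exact | exact: (ch (size s))].
Qed.

Lemma smooth_differentiable U h x : smooth_on U h -> U x -> differentiable h x.
Proof. by move=> /(_ [::] x). Qed.

Lemma C_onS k U h : C_on k.+1 U h <->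
  (forall x, U x -> differentiable h x) /\ forall i, C_on k U (partial i h).
Proof.
split=> [ch|[dh ch] s x]; first split=> [x|i s x ks Ux].
- exact: (ch [::]).
- by have := ch (rcons s i) x; rewrite size_rcons foldr_rcons => /(_ ks Ux).
case: (lastP s) => [_ /dh//|{}s i].
by rewrite size_rcons foldr_rcons => ks Ux; exact: ch.
Qed.

Lemma smooth_partial U h i : smooth_on U h -> smooth_on U (partial i h).
Proof. by move/smooth_onP=> ch; apply/smooth_onP => k; have /C_onS[] := ch k.+1. Qed.

Lemma C_on_leq k U h : C_on k.+1 U h -> C_on k U h.
Proof. by move=> ch s x sk; apply: ch; exact: leqW. Qed.

Lemma eq_on_partials U u v (s : seq 'I_n) : open U -> (forall x, U x -> u x = v x) ->
  forall x, U x -> foldr (@partial R n) u s x = foldr (@partial R n) v s x.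
Proof.
move=> oU uv; elim: s => [//|i s IH] x Ux /=.
by apply: near_eq_partial; apply: filterS IH _; exact: open_nbhs_nbhs.
Qed.

Lemma eq_C_on k U u v : open U -> (forall x, U x -> u x = v x) ->
  C_on k U u -> C_on k U v.
Proof.
move=> oU uv cu s x ks Ux; apply: near_eq_differentiable (cu s x ks Ux).
by apply: filterS (open_nbhs_nbhs (conj oU Ux)); exact: eq_on_partials.
Qed.

Lemma eq_smooth_on U u v : open U -> (forall x, U x -> u x = v x) ->
  smooth_on U u -> smooth_on U v.
Proof.
move=> oU uv /smooth_onP cu; apply/smooth_onP => k.
exact: eq_C_on oU uv (cu k).
Qed.

Lemma C_on_cst k U (a : R) : open U -> C_on k U (fun=> a).
Proof.
move=> oU; elim: k a => [|k IH] a.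
  by move=> [|//] x _ _; exact: differentiable_cst.
apply/C_onS; split=> [x _|i]; first exact: differentiable_cst.
by apply: eq_C_on (IH 0) => // x _; rewrite partial_cst.
Qed.

Lemma smooth_cst U (a : R) : open U -> smooth_on U (fun=> a).
Proof. by move=> oU; apply/smooth_onP => k; exact: C_on_cst. Qed.

Lemma C_onD k U u v : open U -> C_on k U u -> C_on k U v ->
  C_on k U (fun x => u x + v x).
Proof.
move=> oU; elim: k u v => [|k IH] u v cu cv.
  by move=> [|//] x _ Ux; apply: differentiableD; [apply: (cu [::])|apply: (cv [::])].
move/C_onS: cu => [du cu]; move/C_onS: cv => [dv cv].
apply/C_onS; split=> [x Ux|i]; first by apply: differentiableD; auto.
apply: eq_C_on (IH _ _ (cu i) (cv i)) => // x Ux.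
by rewrite partialD; auto.
Qed.

Lemma smoothD U u v : open U -> smooth_on U u -> smooth_on U v ->
  smooth_on U (fun x => u x + v x).
Proof.
move=> oU /smooth_onP cu /smooth_onP cv; apply/smooth_onP => k.
exact: C_onD.
Qed.

Lemma C_onM k U u v : open U -> C_on k U u -> C_on k U v ->
  C_on k U (fun x => u x * v x).
Proof.
move=> oU; elim: k u v => [|k IH] u v cu cv.
  by move=> [|//] x _ Ux; apply: differentiableM; [apply: (cu [::])|apply: (cv [::])].
have cu' := C_on_leq cu; have cv' := C_on_leq cv.
move/C_onS: cu => [du cu]; move/C_onS: cv => [dv cv].
apply/C_onS; split=> [x Ux|i]; first by apply: differentiableM; auto.
apply: eq_C_on (C_onD oU (IH _ _ (cu i) cv') (IH _ _ cu' (cv i))) => // x Ux.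
by rewrite partialM; auto.
Qed.

Lemma smoothM U u v : open U -> smooth_on U u -> smooth_on U v ->
  smooth_on U (fun x => u x * v x).
Proof.
move=> oU /smooth_onP cu /smooth_onP cv; apply/smooth_onP => k.
exact: C_onM.
Qed.

Lemma smoothN U u : open U -> smooth_on U u -> smooth_on U (fun x => - u x).
Proof.
move=> oU su; apply: eq_smooth_on (smoothM oU (smooth_cst (-1) oU) su) => // x _.
by rewrite mulN1r.
Qed.

Lemma smoothV U u : open U -> (forall x, U x -> u x != 0) -> smooth_on U u ->
  smooth_on U (fun x => (u x)^-1).
Proof.
move=> oU u0 su.
have dV x : U x -> differentiable (fun x => (u x)^-1) x.
  by move=> Ux; apply: differentiableV; [exact: (su [::])|exact: u0].
apply/smooth_onP; elim=> [|k IH]; first by move=> [|//] x _ /dV.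
apply/C_onS; split=> // i.
have /smooth_onP/(_ k) cN := smoothN oU (smooth_partial i su).
apply: eq_C_on (C_onM oU (C_onM oU IH IH) cN) => // x Ux.
by rewrite partialV ?u0 //; [rewrite mulrN !mulNr|exact: (su [::])].
Qed.

Lemma smooth_sum (I : Type) (r : seq I) U (u : I -> 'rV[R]_n -> R) :
  open U -> (forall k, smooth_on U (u k)) ->
  smooth_on U (fun x => \sum_(k <- r) u k x).
Proof.
move=> oU su; elim: r => [|k r IH].
  by apply: eq_smooth_on (smooth_cst 0 oU) => // x _; rewrite big_nil.
by apply: eq_smooth_on (smoothD oU (su k) IH) => // x _; rewrite big_cons.
Qed.

Lemma smooth_prod (I : Type) (r : seq I) U (u : I -> 'rV[R]_n -> R) :
  open U -> (forall k, smooth_on U (u k)) ->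
  smooth_on U (fun x => \prod_(k <- r) u k x).
Proof.
move=> oU su; elim: r => [|k r IH].
  by apply: eq_smooth_on (smooth_cst 1 oU) => // x _; rewrite big_nil.
by apply: eq_smooth_on (smoothM oU (su k) IH) => // x _; rewrite big_cons.
Qed.

End Partial.

(** * Chain rules and the symmetry of second derivatives *)

Section ChainRule.
Context {R : realType} {n : nat}.
Implicit Types (h : 'rV[R]_n -> R) (U : set 'rV[R]_n) (x v : 'rV[R]_n).

Lemma diffE_partial h x v : differentiable h x ->
  'd h x v = \sum_(k < n) partial k h x * v 0 k.
Proof.
move=> dh; rewrite {1}(row_sum_delta v) linear_sum; apply: eq_bigr => k _.
by rewrite linearZ /partial deriveE // mulrC.
Qed.

Lemma chain_curve h (c : R -> 'rV[R]_n) t v : differentiable h (c t) ->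
  (forall k, is_derive t 1 (fun s => c s 0 k) (v 0 k)) ->
  is_derive t 1 (fun s => h (c s)) (\sum_(k < n) partial k h (c t) * v 0 k).
Proof.
move=> dh dc.
have cD : derivable c t 1.
  by apply/derivable_mxP => i j; rewrite (ord1 i); exact: (@ex_derive _ _ _ _ _ _ _ (dc j)).
have cd : differentiable c t by exact/derivable1_diffP.
have cE : 'd c t 1 = v.
  rewrite -deriveE // derive_mx //; apply/rowP => k.
  by rewrite mxE; exact: (@derive_val _ _ _ _ _ _ _ (dc k)).
have hcd : differentiable (h \o c) t by exact: differentiable_comp.
apply: DeriveDef; first exact/derivable1_diffP.
by rewrite -[fun _ => _]/(h \o c) deriveE // diff_comp //= cE diffE_partial.
Qed.

Lemma is_derive_line h x v t : differentiable h (x + t *: v) ->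
  is_derive t 1 (fun s => h (x + s *: v))
    (\sum_(k < n) partial k h (x + t *: v) * v 0 k).
Proof.
move=> dh; apply: (@chain_curve h (fun s => x + s *: v) t v dh) => k.
rewrite (_ : (fun _ => _) = cst (x 0 k) + (fun s => s * v 0 k)); last first.
  by apply/funext => s; rewrite !mxE.
apply: is_derive_eq; rewrite add0r.
by rewrite scaler0 add0r /GRing.scale/= mulr1.
Qed.

Lemma partial_line i h x t : differentiable h (x + t *: delta_mx 0 i) ->
  is_derive t 1 (fun s => h (x + s *: delta_mx 0 i))
    (partial i h (x + t *: delta_mx 0 i)).
Proof.
move=> dh; have := is_derive_line dh; rewrite (bigD1 i) //= mxE !eqxx mulr1.
rewrite big1 ?addr0 // => k ki; rewrite mxE eqxx (negPf ki).
by rewrite mulr0.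
Qed.

Lemma partialE_line i h x :
  partial i h x = 'D_1 (fun s : R => h (x + s *: delta_mx 0 i)) 0.
Proof.
rewrite /partial /derive; congr (lim (_ @ 0^')); apply/funext => s /=.
by rewrite [s%:A]mulr1 scale0r !addr0 [x + _]addrC.
Qed.

End ChainRule.

Lemma partial_comp (R : realType) n m r (T : 'rV[R]_n -> 'rV[R]_m)
    (h : 'rV[R]_m -> R) (x : 'rV[R]_n) :
  (forall s, differentiable (fun y => T y 0 s) x) -> differentiable h (T x) ->
  partial r (fun y => h (T y)) x =
    \sum_(s < m) partial r (fun y => T y 0 s) x * partial s h (T x).
Proof.
move=> dT dh; rewrite partialE_line.
pose v := \row_s partial r (fun y => T y 0 s) x.
have dc k : is_derive (0 : R) (1 : R)
    (fun s : R => T (x + s *: delta_mx 0 r) 0 k) (v 0 k).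
  have := @partial_line R n r (fun y => T y 0 k) x 0.
  by rewrite scale0r addr0 mxE; apply.
have dh0 : differentiable h (T (x + 0 *: delta_mx 0 r)) by rewrite scale0r addr0.
have /@derive_val -> := chain_curve dh0 dc.
by apply: eq_bigr => s _; rewrite mxE scale0r addr0 mulrC.
Qed.



Section Symmetry.
Context {R : realType} {n : nat}.
Implicit Types (h : 'rV[R]_n -> R) (U : set 'rV[R]_n) (x : 'rV[R]_n).

Let MVTd (k dk : R -> R) (d : R) : 0 < d ->
  (forall s, 0 <= s <= d -> is_derive s 1 k (dk s)) ->
  exists2 s, 0 <= s <= d & k d - k 0 = dk s * d.
Proof.
move=> d0 dkP.
have [||s s01 ->] := @MVT R k dk 0 d d0.
- by move=> s; rewrite in_itv/= => /andP[s0 sd]; apply: dkP; rewrite !ltW.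
- apply: derivable_within_continuous => s; rewrite in_itv/= => /dkP dks.
  exact: (@ex_derive _ _ _ _ _ _ _ dks).
exists s; last by rewrite subr0.
by move: s01; rewrite in_itv/= => /andP[s0 sd]; rewrite !ltW.
Qed.

(** The second difference over a small square is a difference, in the direction
    j, of differences in the direction i: the mean value theorem applies to each
    of the two. *)
Lemma second_difference i j h x (d : R) : 0 < d ->
  (forall s t, 0 <= s <= d -> 0 <= t <= d ->
    differentiable h (x + s *: delta_mx 0 i + t *: delta_mx 0 j) /\
    differentiable (partial i h) (x + s *: delta_mx 0 i + t *: delta_mx 0 j)) ->
  exists s t, [/\ 0 <= s <= d, 0 <= t <= d &
    h (x + d *: delta_mx 0 i + d *: delta_mx 0 j) - h (x + d *: delta_mx 0 i)
      - h (x + d *: delta_mx 0 j) + h x =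
    partial j (partial i h) (x + s *: delta_mx 0 i + t *: delta_mx 0 j) * d * d].
Proof.
move=> d0 dh; set a := delta_mx 0 i; set b := delta_mx 0 j.
have dd : 0 <= d <= d by rewrite lexx ltW.
have zd : (0 : R) <= 0 <= d by rewrite lexx ltW.
pose k s := h (x + d *: b + s *: a) - h (x + s *: a).
have [|s sd ks] := @MVTd k
  (fun s => partial i h (x + d *: b + s *: a) - partial i h (x + s *: a)) d d0.
  move=> s sd; have [h1 _] := dh s d sd dd; have [h2 _] := dh s 0 sd zd.
  rewrite addrAC in h1; rewrite scale0r addr0 in h2.
  by apply: is_deriveB; apply: partial_line.
have [|t td kt] := @MVTd (fun t => partial i h (x + s *: a + t *: b))
  (fun t => partial j (partial i h) (x + s *: a + t *: b)) d d0.
  by move=> t td; apply: partial_line; have [] := dh s t sd td.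
exists s, t; split=> //; rewrite -kt scale0r addr0 [x + s *: a + _]addrAC -ks /k.
by rewrite scale0r !addr0 [x + d *: a + _]addrAC; ring.
Qed.

(** The second difference does not depend on the order of i and j, and both
    mixed derivatives are continuous. *)
Lemma partialC i j U h x : open U -> smooth_on U h -> U x ->
  partial i (partial j h) x = partial j (partial i h) x.
Proof.
move=> oU sh Ux; set A := partial i (partial j h); set B := partial j (partial i h).
have cA : {for x, continuous A}.
  by apply: differentiable_continuous; exact: (sh [:: i; j]).
have cB : {for x, continuous B}.
  by apply: differentiable_continuous; exact: (sh [:: j; i]).
apply/eqP; rewrite -subr_eq0 -normr_le0; apply/ler_addgt0Pr => e e0; rewrite add0r.
have e2 : 0 < e / 2 by rewrite divr_gt0.
have : \forall y \near x, [/\ U y, `|A x - A y| < e / 2 & `|B x - B y| < e / 2].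
  have UN : \forall y \near x, U y by exact: open_nbhs_nbhs.
  have AN : \forall y \near x, `|A x - A y| < e / 2 by move/cvgrPdist_lt: cA; apply.
  have BN : \forall y \near x, `|B x - B y| < e / 2 by move/cvgrPdist_lt: cB; apply.
  by apply: filterS3 UN AN BN => y *; split.
case/nbhs_ballP => r /= r0 rP.
set a := delta_mx 0 i : 'rV[R]_n; set b := delta_mx 0 j : 'rV[R]_n.
have N0 : 0 < `|a| + `|b| + 1 by rewrite ltr_wpDl // addr_ge0.
pose d := r / (`|a| + `|b| + 1).
have d0 : 0 < d by rewrite divr_gt0.
have inb s t : 0 <= s <= d -> 0 <= t <= d -> ball x r (x + s *: a + t *: b).
  move=> /andP[s0 sd] /andP[t0 td]; rewrite -ball_normE /= -addrA opprD addNKr normrN.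
  rewrite (le_lt_trans (ler_normD _ _)) // !normrZ !ger0_norm //.
  have : s * `|a| + t * `|b| <= d * (`|a| + `|b|).
    by rewrite mulrDr lerD // ler_wpM2r.
  move/le_lt_trans; apply; rewrite -[ltRHS](divfK (lt0r_neq0 N0)) -/d.
  by rewrite ltr_pM2l // ltrDl.
have [s t sd td|s [t [sd td E1]]] := @second_difference i j h x d d0.
  have [Uy _ _] := rP _ (inb s t sd td).
  by split; [exact: (sh [::])|exact: (sh [:: i])].
have [s' t' sd' td'|s' [t' [sd' td' E2]]] := @second_difference j i h x d d0.
  have [Uy _ _] := rP _ (inb t' s' td' sd').
  by rewrite addrAC; split; [exact: (sh [::])|exact: (sh [:: j])].
have [_ _ Bxy] := rP _ (inb s t sd td).
have [_ Axy _] := rP _ (inb t' s' td' sd').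
have AB : A (x + t' *: a + s' *: b) = B (x + s *: a + t *: b).
  have dn0 := lt0r_neq0 d0.
  apply: (mulIf dn0); apply: (mulIf dn0); rewrite [x + t' *: a + _]addrAC.
  transitivity (h (x + d *: b + d *: a) - h (x + d *: b) - h (x + d *: a) + h x).
    by symmetry; exact: E2.
  transitivity (h (x + d *: a + d *: b) - h (x + d *: a) - h (x + d *: b) + h x).
    by rewrite [x + d *: b + _]addrAC -!addrA; congr (_ + _); rewrite addrCA.
  exact: E1.
have close (p q p' q' : R) :
    p' = q' -> `|p - p'| < e / 2 -> `|q - q'| < e / 2 -> `|p - q| <= e.
  move=> -> pq qq; rewrite -(subrKA q') (splitr e).
  apply: (le_trans (ler_normD _ _)); apply: lerD; first exact: ltW.
  by rewrite distrC; exact: ltW.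
exact: close AB Axy Bxy.
Qed.

End Symmetry.

(** * Matrix-valued functions *)

Section Entries.
Context {R : nzRingType} {m p : nat}.
Implicit Types (A B : 'M[R]_(m, p)).

Lemma addE A B i j : (A + B) i j = A i j + B i j. Proof. exact: mxE. Qed.
Lemma oppE A i j : (- A) i j = - A i j. Proof. exact: mxE. Qed.
Lemma scaleE a A i j : (a *: A) i j = a * A i j. Proof. exact: mxE. Qed.
Lemma zeroE i j : (0 : 'M[R]_(m, p)) i j = 0. Proof. exact: mxE. Qed.
Lemma trE A i j : A^T i j = A j i. Proof. exact: mxE. Qed.
Lemma mulE q A (B : 'M[R]_(p, q)) i j : (A *m B) i j = \sum_k A i k * B k j.
Proof. exact: mxE. Qed.

End Entries.

Lemma trmxD (R : zmodType) m p (A B : 'M[R]_(m, p)) : (A + B)^T = A^T + B^T.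
Proof. by apply/matrixP => i j; rewrite !mxE. Qed.

Lemma trmxN (R : zmodType) m p (A : 'M[R]_(m, p)) : (- A)^T = - A^T.
Proof. by apply/matrixP => i j; rewrite !mxE. Qed.

(** An identity between sums of products of matrices is, entry by entry and
    after distributing, an identity of commutative rings between entries of
    products. *)
Ltac mx_ring :=
  rewrite ?(mulmxDl, mulmxDr, mulmxBl, mulmxBr, mulmxN, mulNmx, mulmxA);
  repeat match goal with
  | |- context [ ?A *m ?B ] =>
      let M := fresh "M" in set M := (A *m B); clearbody M
  end;
  apply/matrixP => ? ?; rewrite !mxE; ring.

(** Locked so that comparing two derivatives never unfolds them into limits. *)
HB.lock Definition partial_mx (R : realType) (n p q : nat) (i : 'I_n)
    (X : 'rV[R]_n -> 'M[R]_(p, q)) (x : 'rV[R]_n) : 'M[R]_(p, q) :=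
  \matrix_(a, b) partial i (fun y => X y a b) x.

Section MatrixCalculus.
Context {R : realType} {n : nat} {U : set 'rV[R]_n}.
Hypothesis oU : open U.
Implicit Types (i j : 'I_n) (x : 'rV[R]_n).

Definition smooth_mx p q (X : 'rV[R]_n -> 'M[R]_(p, q)) : Prop :=
  forall a b, smooth_on U (fun x => X x a b).

Lemma partial_mxE p q i (X : 'rV[R]_n -> 'M[R]_(p, q)) x a b :
  partial_mx i X x a b = partial i (fun y => X y a b) x.
Proof. by rewrite partial_mx.unlock mxE. Qed.

Lemma smooth_mx_diff p q (X : 'rV[R]_n -> 'M[R]_(p, q)) x a b :
  smooth_mx X -> U x -> differentiable (fun y => X y a b) x.
Proof. by move=> sX Ux; exact: (sX a b [::]). Qed.

Lemma eq_partial_mx p q i (X Y : 'rV[R]_n -> 'M[R]_(p, q)) x : U x ->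
  (forall y, U y -> X y = Y y) -> partial_mx i X x = partial_mx i Y x.
Proof.
move=> Ux XY; apply/matrixP => a b; rewrite !partial_mxE; apply: near_eq_partial.
by apply: filterS (open_nbhs_nbhs (conj oU Ux)) => y /XY ->.
Qed.

Lemma eq_smooth_mx p q (X Y : 'rV[R]_n -> 'M[R]_(p, q)) :
  (forall y, U y -> X y = Y y) -> smooth_mx X -> smooth_mx Y.
Proof.
by move=> XY sX a b; apply: eq_smooth_on (sX a b) => // x /XY ->.
Qed.

Lemma smooth_mx_cst p q (A : 'M[R]_(p, q)) : smooth_mx (fun=> A).
Proof. by move=> a b; exact: smooth_cst. Qed.

Lemma partial_mx_cst p q i (A : 'M[R]_(p, q)) x : partial_mx i (fun=> A) x = 0.
Proof. by apply/matrixP => a b; rewrite partial_mxE mxE partial_cst. Qed.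

Lemma smooth_partial_mx p q i (X : 'rV[R]_n -> 'M[R]_(p, q)) :
  smooth_mx X -> smooth_mx (partial_mx i X).
Proof.
move=> sX a b; apply: eq_smooth_on (smooth_partial i (sX a b)) => // x _.
by rewrite partial_mxE.
Qed.

Lemma smooth_mxD p q (X Y : 'rV[R]_n -> 'M[R]_(p, q)) :
  smooth_mx X -> smooth_mx Y -> smooth_mx (fun y => X y + Y y).
Proof.
move=> sX sY a b; apply: eq_smooth_on (smoothD oU (sX a b) (sY a b)) => // x _.
by rewrite mxE.
Qed.

Lemma partial_mxD p q i (X Y : 'rV[R]_n -> 'M[R]_(p, q)) x : U x ->
  smooth_mx X -> smooth_mx Y ->
  partial_mx i (fun y => X y + Y y) x = partial_mx i X x + partial_mx i Y x.
Proof.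
move=> Ux sX sY; apply/matrixP => a b; rewrite !(partial_mxE, mxE) -partialD; last 2 first.
- exact: smooth_mx_diff.
- exact: smooth_mx_diff.
by apply: eq_partial => y; rewrite mxE.
Qed.

Lemma smooth_mxN p q (X : 'rV[R]_n -> 'M[R]_(p, q)) :
  smooth_mx X -> smooth_mx (fun y => - X y).
Proof.
move=> sX a b; apply: eq_smooth_on (smoothN oU (sX a b)) => // x _.
by rewrite mxE.
Qed.

Lemma partial_mxN p q i (X : 'rV[R]_n -> 'M[R]_(p, q)) x : U x ->
  smooth_mx X -> partial_mx i (fun y => - X y) x = - partial_mx i X x.
Proof.
move=> Ux sX; apply/matrixP => a b; rewrite !(partial_mxE, mxE) -partialN; last first.
  exact: smooth_mx_diff.
by apply: eq_partial => y; rewrite mxE.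
Qed.

Lemma smooth_mxT p q (X : 'rV[R]_n -> 'M[R]_(p, q)) :
  smooth_mx X -> smooth_mx (fun y => (X y)^T).
Proof.
by move=> sX a b; apply: eq_smooth_on (sX b a) => // x _; rewrite mxE.
Qed.

Lemma partial_mxT p q i (X : 'rV[R]_n -> 'M[R]_(p, q)) x :
  partial_mx i (fun y => (X y)^T) x = (partial_mx i X x)^T.
Proof.
apply/matrixP => a b; rewrite !(partial_mxE, mxE).
by apply: eq_partial => y; rewrite mxE.
Qed.

Lemma smooth_mxM p q r (X : 'rV[R]_n -> 'M[R]_(p, q)) (Y : 'rV[R]_n -> 'M[R]_(q, r)) :
  smooth_mx X -> smooth_mx Y -> smooth_mx (fun y => X y *m Y y).
Proof.
move=> sX sY a b.
have := smooth_sum (index_enum 'I_q) oU (fun k => smoothM oU (sX a k) (sY k b)).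
by apply: eq_smooth_on => // x _; rewrite mxE.
Qed.

Lemma partial_mxM p q r i (X : 'rV[R]_n -> 'M[R]_(p, q))
    (Y : 'rV[R]_n -> 'M[R]_(q, r)) x : U x -> smooth_mx X -> smooth_mx Y ->
  partial_mx i (fun y => X y *m Y y) x =
    partial_mx i X x *m Y x + X x *m partial_mx i Y x.
Proof.
move=> Ux sX sY; apply/matrixP => a b; rewrite partial_mxE.
transitivity (partial i (fun y => \sum_k X y a k * Y y k b) x).
  by apply: eq_partial => y; rewrite mxE.
rewrite partial_sum; last first.
  by move=> k; apply: differentiableM; exact: smooth_mx_diff.
rewrite [RHS]mxE [X in X + _]mxE [X in _ + X]mxE -big_split; apply: eq_bigr => k _.
rewrite /= partialM; [|exact: smooth_mx_diff..].
by rewrite !partial_mxE.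
Qed.

Lemma partial_mxC p q i j (X : 'rV[R]_n -> 'M[R]_(p, q)) x : U x ->
  smooth_mx X ->
  partial_mx i (partial_mx j X) x = partial_mx j (partial_mx i X) x.
Proof.
move=> Ux sX; apply/matrixP => a b.
have E k l : partial_mx k (partial_mx l X) x a b =
    partial k (partial l (fun y => X y a b)) x.
  by rewrite partial_mxE; apply: eq_partial => y; exact: partial_mxE.
apply: (etrans (E i j)); apply: (etrans (partialC i j oU (sX a b) Ux)).
by symmetry; exact: E.
Qed.

Lemma smooth_det p (X : 'rV[R]_n -> 'M[R]_p) : smooth_mx X ->
  smooth_on U (fun y => \det (X y)).
Proof.
move=> sX; have smooth_term (s : 'S_p) :
    smooth_on U (fun y => (-1) ^+ s * \prod_i X y i (s i)).
  by apply: smoothM => //; [exact: smooth_cst|exact: smooth_prod].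
exact: eq_smooth_on (smooth_sum _ oU smooth_term).
Qed.

Lemma smooth_invmx p (X : 'rV[R]_n -> 'M[R]_p) : smooth_mx X ->
  (forall x, U x -> X x \in unitmx) -> smooth_mx (fun y => invmx (X y)).
Proof.
move=> sX uX a b.
have d0 x : U x -> \det (X x) != 0 by move=> /uX; rewrite unitmxE unitfE.
have sV := smoothV oU d0 (smooth_det sX).
have sC : smooth_on U (fun y => cofactor (X y) b a).
  apply: smoothM => //; first exact: smooth_cst.
  apply: smooth_det => c d.
  by apply: eq_smooth_on (sX (lift b c) (lift a d)) => // x _; rewrite !mxE.
apply: eq_smooth_on (smoothM oU sV sC) => // x Ux.
by rewrite /invmx uX // !mxE.
Qed.

End MatrixCalculus.
Arguments smooth_mx {R n} U {p q} X.

(** * Linear algebra of inner products *)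

(** In a rank factorization N = C B the product B C is the identity of size
    rank N. *)
Lemma mxtrace_idempotent (F : fieldType) n (N : 'M[F]_n) :
  N *m N = N -> \tr N = (\rank N)%:R.
Proof.
move=> NN; suff rank_factorization r (C : 'M[F]_(n, r)) (B : 'M[F]_(r, n)) :
    row_full C -> row_free B -> C *m B = N -> \tr N = r%:R.
  exact: rank_factorization (col_base_full N) (row_base_free N) (mulmx_base N).
move=> /row_fullP[C' CC'] /row_freeP[B' BB'] NE.
suff BC : B *m C = 1%:M by rewrite -NE mxtrace_mulC BC mxtrace1.
have E : C *m (B *m C) *m B = C *m B by rewrite !mulmxA NE -mulmxA NE NN.
have := congr1 (fun X => C' *m X *m B') E.
by rewrite /= -!mulmxA BB' !mulmx1 !mulmxA CC' !mul1mx.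
Qed.

Section InnerProduct.
Context {R : realType} {n : nat}.
Variable g : 'M[R]_n.
Hypothesis gT : g^T = g.
Hypothesis gpos : forall v : 'rV[R]_n, v != 0 -> 0 < (v *m g *m v^T) 0 0.

Lemma posdef_unitmx : g \in unitmx.
Proof.
rewrite unitmxE unitfE; apply/det0P => -[v v0 vg].
by have := gpos v0; rewrite vg mul0mx mxE ltxx.
Qed.

Lemma posdef_ge0 (v : 'rV[R]_n) : 0 <= (v *m g *m v^T) 0 0.
Proof.
have [->|/gpos/ltW//] := eqVneq v 0.
by rewrite !mul0mx mxE.
Qed.

Let uT : (invmx g)^T = invmx g. Proof. by rewrite trmx_inv gT. Qed.

Lemma invmx_pos (w : 'cV[R]_n) : w != 0 -> 0 < (w^T *m invmx g *m w) 0 0.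
Proof.
move=> w0; have := @gpos (w^T *m invmx g).
rewrite trmx_mul trmxK uT (mulmxKV posdef_unitmx) mulmxA; apply.
apply: contraNneq w0 => /(congr1 (mulmx^~ g)).
rewrite mul0mx (mulmxKV posdef_unitmx) => /(congr1 trmx).
by rewrite trmxK trmx0 => ->.
Qed.

(** The vector u is the component of v orthogonal to the vector dual to w. *)
Lemma orthogonal_part (v : 'rV[R]_n) (w : 'cV[R]_n)
    (q := (w^T *m invmx g *m w) 0 0) (F := (v *m w) 0 0)
    (u := v - (F / q) *: (invmx g *m w)^T) : w != 0 ->
  (u *m g *m u^T) 0 0 = (v *m g *m v^T) 0 0 - F ^+ 2 / q.
Proof.
move=> w0; have q0 : q != 0 by rewrite gt_eqF // invmx_pos.
have E1 : (v *m g *m (invmx g *m w)) 0 0 = F by rewrite mulmxA (mulmxK posdef_unitmx).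
have E2 : ((invmx g *m w)^T *m g *m v^T) 0 0 = F.
  rewrite trmx_mul uT (mulmxKV posdef_unitmx).
  by rewrite -trmx_mul mxE.
have E3 : ((invmx g *m w)^T *m g *m (invmx g *m w)) 0 0 = q.
  by rewrite trmx_mul uT (mulmxKV posdef_unitmx) mulmxA.
set t := F / q in u *.
have -> : u *m g *m u^T = v *m g *m v^T - t *: (v *m g *m (invmx g *m w))
    - t *: ((invmx g *m w)^T *m g *m v^T)
    + t ^+ 2 *: ((invmx g *m w)^T *m g *m (invmx g *m w)).
  have -> : u^T = v^T - t *: (invmx g *m w).
    by apply/matrixP => i j; rewrite !mxE.
  rewrite /u mulmxBl mulmxBl !mulmxBr -!scalemxAl -!scalemxAr scalerA -expr2.
  by mx_ring.
rewrite !(addE, oppE, scaleE) E1 E2 E3 /t.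
by field.
Qed.

Lemma Cauchy_Schwarz (v : 'rV[R]_n) (w : 'cV[R]_n) :
  (v *m w) 0 0 ^+ 2 <= (w^T *m invmx g *m w) 0 0 * (v *m g *m v^T) 0 0.
Proof.
have [->|w0] := eqVneq w 0; first by rewrite !mulmx0 !mxE expr0n mul0r.
have := posdef_ge0 (v - ((v *m w) 0 0 / (w^T *m invmx g *m w) 0 0) *: (invmx g *m w)^T).
rewrite orthogonal_part // subr_ge0 ler_pdivrMr ?invmx_pos //.
by rewrite mulrC.
Qed.

End InnerProduct.

(** Gram-Schmidt by induction on the dimension: L clears the first row and column
    of g with the help of the pivot a. *)
Lemma posdef_orthonormal (R : realType) n (g : 'M[R]_n) : g^T = g ->
  (forall v : 'rV[R]_n, v != 0 -> 0 < (v *m g *m v^T) 0 0) ->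
  exists P : 'M[R]_n, P *m g *m P^T = 1%:M.
Proof.
elim: n g => [|n IH] g gT gpos.
  by exists 0; apply/matrixP => -[].
rewrite -[n.+1]/(1 + n)%N in g gT gpos *.
pose a := g 0 0; pose b := ursubmx g; pose d := drsubmx g.
have gE : g = block_mx a%:M b b^T d.
  rewrite -[LHS]submxK; congr block_mx; last by rewrite trmx_ursub gT.
  by rewrite [LHS]mx11_scalar; congr (_%:M); rewrite !mxE; congr (g _ _); apply/val_inj.
have dT : d^T = d by rewrite trmx_drsub gT.
have a0 : 0 < a.
  have := gpos (delta_mx 0 0); rewrite -rowE trmx_delta -colE !mxE; apply.
  by apply/eqP => /matrixP/(_ 0 0)/eqP; rewrite !mxE !eqxx oner_eq0.
have an0 : a != 0 by rewrite gt_eqF.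
pose L : 'M[R]_(1 + n) := block_mx 1%:M 0 (- (a^-1 *: b^T)) 1%:M.
pose d' := d - a^-1 *: (b^T *m b).
have LgL : L *m g *m L^T = block_mx a%:M 0 0 d'.
  have LT : L^T = block_mx 1%:M (- (a^-1 *: b)) 0 1%:M.
    rewrite tr_block_mx !trmx1 trmx0; congr block_mx.
    by apply/matrixP => i j; rewrite !mxE.
  have Lg : L *m g = block_mx a%:M b 0 d'.
    rewrite gE mulmx_block !mul1mx !mul0mx !addr0 mulNmx -scalemxAl mul_mx_scalar.
    by rewrite scalerA mulVf // scale1r addNr mulNmx -scalemxAl addrC.
  rewrite Lg LT mulmx_block !mulmx1 !mulmx0 !mul0mx !addr0 add0r.
  by rewrite mulmxN mul_scalar_mx scalerA divff // scale1r addNr.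
have LgLE k (X : 'M[R]_(k, 1 + n)) :
    X *m L *m g *m (X *m L)^T = X *m block_mx a%:M 0 0 d' *m X^T.
  by rewrite -LgL trmx_mul !mulmxA.
have [|u u0|P' P'P] := IH d'.
- rewrite /d' trmxD trmxN dT; congr (_ - _); rewrite linearZ /= trmx_mul.
  by rewrite trmxK.
- have v0 : row_mx 0 u *m L != 0.
    rewrite /L mul_row_block !(mul0mx, mulmx1, add0r).
    by apply: contraNneq u0; rewrite -row_mx0 => /eq_row_mx[_ ->].
  have := gpos _ v0; rewrite LgLE mul_row_block !mul0mx !mulmx0 !add0r tr_row_mx mul_row_col trmx0.
  by rewrite mul0mx add0r.
exists (block_mx (Num.sqrt a)^-1%:M 0 0 P' *m L).
rewrite LgLE tr_block_mx !trmx0 !mulmx_block !mulmx0 !mul0mx !addr0 !add0r P'P.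
have -> : (Num.sqrt a)^-1%:M *m a%:M *m (Num.sqrt a)^-1%:M^T = 1%:M :> 'M[R]_1.
  have s0 : Num.sqrt a != 0 by rewrite gt_eqF // sqrtr_gt0.
  rewrite tr_scalar_mx -!scalar_mxM -{2}(sqr_sqrtr (ltW a0)).
  by congr (_%:M); field.
by rewrite !mul0mx -scalar_mx_block.
Qed.

(** In an orthonormal frame the trace of the square of a self-adjoint
    endomorphism is the sum of the squares of its entries. *)
Lemma trace_square_eq0 (R : realType) n (g A : 'M[R]_n) : g^T = g ->
  (forall v : 'rV[R]_n, v != 0 -> 0 < (v *m g *m v^T) 0 0) -> A^T = A ->
  \tr (invmx g *m A *m invmx g *m A) = 0 -> \tr (invmx g *m A) = 0.
Proof.
move=> gT gpos AT; have [P PP] := posdef_orthonormal gT gpos.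
have gu := posdef_unitmx gpos.
have PTP : P^T *m P = invmx g.
  have PgPT : P *m (g *m P^T) = 1%:M by rewrite mulmxA.
  by rewrite -[LHS](mulKmx gu) (mulmxA g) (mulmx1C PgPT) mulmx1.
pose B := P *m A *m P^T.
have BT : B^T = B by rewrite /B !trmx_mul trmxK AT mulmxA.
have -> : \tr (invmx g *m A) = \tr B by rewrite -PTP -mulmxA mxtrace_mulC.
have -> : \tr (invmx g *m A *m invmx g *m A) = \tr (B *m B^T).
  by rewrite BT -PTP /B -!mulmxA mxtrace_mulC !mulmxA.
have -> : \tr (B *m B^T) = \sum_i \sum_j B i j ^+ 2.
  by apply: eq_bigr => i _; rewrite mulE; apply: eq_bigr => j _; rewrite trE expr2.
have B2 i j : 0 <= B i j ^+ 2 by exact: sqr_ge0.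
move/eqP; rewrite psumr_eq0 => [/allP B0|i _]; last exact: sumr_ge0.
apply: big1 => i _; have := B0 i; rewrite mem_index_enum => /(_ isT).
rewrite psumr_eq0 // => /allP/(_ i); rewrite mem_index_enum => /(_ isT).
by rewrite /= sqrf_eq0 => /eqP.
Qed.

(** The constant is a smooth function of the entries of A and of the inverse of g,
    hence locally bounded when these vary smoothly; to this end 1 + a ^+ 2
    replaces the absolute value of a.  Each coordinate of u is bounded by
    Cauchy-Schwarz. *)
Lemma quadratic_form_bound (R : realType) n (g A : 'M[R]_n) (u : 'rV[R]_n) :
  g^T = g -> (forall v : 'rV[R]_n, v != 0 -> 0 < (v *m g *m v^T) 0 0) ->
  `|(u *m A *m u^T) 0 0| <=
    (\sum_i \sum_j (1 + A i j ^+ 2) * (invmx g i i + invmx g j j))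
      * (u *m g *m u^T) 0 0.
Proof.
move=> gT gpos; set Q := (u *m g *m u^T) 0 0.
have CS i : u 0 i ^+ 2 <= invmx g i i * Q.
  have := Cauchy_Schwarz gT gpos u (delta_mx i 0).
  by rewrite -/Q -colE trmx_delta -rowE -colE !mxE.
have -> : (u *m A *m u^T) 0 0 = \sum_i \sum_j u 0 i * A i j * u 0 j.
  rewrite mulE exchange_big; apply: eq_bigr => j _.
  by rewrite mulE trE mulr_suml.
rewrite mulr_suml (le_trans (ler_norm_sum _ _ _)) //; apply: ler_sum => i _.
rewrite mulr_suml (le_trans (ler_norm_sum _ _ _)) //; apply: ler_sum => j _.
have A1 : `|A i j| <= 1 + A i j ^+ 2.
  rewrite -(real_normK (num_real (A i j))); have := sqr_ge0 (`|A i j| - 1).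
  have := normr_ge0 (A i j); nra.
rewrite !normrM mulrAC mulrC -mulrA; rewrite ler_pM ?mulr_ge0 //.
rewrite mulrDl; apply: le_trans (lerD (CS i) (CS j)).
rewrite -!(real_normK (num_real (u 0 _))).
have := sqr_ge0 (`|u 0 i| - `|u 0 j|).
have : 0 <= `|u 0 i| * `|u 0 j| by rewrite mulr_ge0.
nra.
Qed.

(** * Levi-Civita connection and curvature in a coordinate domain *)

(** The matrices of the Levi-Civita connection: row j of [Gam g i x] holds the
    components of the covariant derivative of the j-th coordinate field in the
    i-th direction. *)
HB.lock Definition Gam (R : realType) (n : nat) (g : 'rV[R]_n -> 'M[R]_n)
    (i : 'I_n) (x : 'rV[R]_n) : 'M[R]_n :=
  \matrix_(j, k) christoffel g k i j x.

Lemma GamE (R : realType) n (g : 'rV[R]_n -> 'M[R]_n) i x j k :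
  Gam g i x j k = christoffel g k i j x.
Proof. by rewrite Gam.unlock mxE. Qed.

HB.lock Definition df_col (R : realType) (n : nat) (f : 'rV[R]_n -> R)
    (x : 'rV[R]_n) : 'cV[R]_n := \col_k partial k f x.

Lemma df_colE (R : realType) n (f : 'rV[R]_n -> R) x k :
  df_col f x k 0 = partial k f x.
Proof. by rewrite df_col.unlock mxE. Qed.

Section CurveCalculus.
Context {R : realType}.

Definition is_derive_mx p q (t : R) (X : R -> 'M[R]_(p, q)) (dX : 'M[R]_(p, q)) :=
  forall a b, is_derive t 1 (fun s => X s a b) (dX a b).

Lemma is_derive_mxT p q t (X : R -> 'M[R]_(p, q)) dX :
  is_derive_mx t X dX -> is_derive_mx t (fun s => (X s)^T) dX^T.
Proof.
move=> dXP a b; rewrite trE.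
by rewrite (_ : (fun s => _) = (fun s => X s b a)) //; apply/funext => s; rewrite trE.
Qed.

Lemma is_derive_mxM p q r t (X : R -> 'M[R]_(p, q)) (Y : R -> 'M[R]_(q, r)) dX dY :
  is_derive_mx t X dX -> is_derive_mx t Y dY ->
  is_derive_mx t (fun s => X s *m Y s) (dX *m Y t + X t *m dY).
Proof.
move=> dXP dYP a b.
rewrite (_ : (fun s => _) = \sum_k (fun s => X s a k * Y s k b)); last first.
  by apply/funext => s; rewrite mulE fct_sumE.
rewrite addE !mulE -big_split /=; apply: is_derive_sum => k.
have dk := is_deriveM (dXP a k) (dYP k b).
by apply: is_derive_eq; rewrite addrC /GRing.scale/= [Y t k b * _]mulrC.
Qed.

End CurveCalculus.

Section Connection.
Context {R : realType} {n : nat} {U : set 'rV[R]_n} {g : 'rV[R]_n -> 'M[R]_n}.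
Hypotheses (oU : open U) (sg : smooth_mx U g).
Hypothesis gT : forall x, U x -> (g x)^T = g x.
Hypothesis gu : forall x, U x -> g x \in unitmx.
Implicit Types (i j k l : 'I_n) (x : 'rV[R]_n).

Local Notation G := (fun x => invmx (g x)).
Local Notation Ga := (Gam g).

Lemma smooth_G : smooth_mx U G.
Proof. exact: smooth_invmx. Qed.

Lemma gK x : U x -> g x *m invmx (g x) = 1%:M.
Proof. by move=> /gu; exact: mulmxV. Qed.

Lemma Kg x : U x -> invmx (g x) *m g x = 1%:M.
Proof. by move=> /gu; exact: mulVmx. Qed.

Lemma invgT x : U x -> (invmx (g x))^T = invmx (g x).
Proof. by move=> Ux; rewrite trmx_inv gT. Qed.

(** Twice the Christoffel symbols of the first kind. *)
Definition first_kind i x : 'M[R]_n := \matrix_(j, l)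
  (partial_mx i g x j l + partial_mx j g x i l - partial_mx l g x i j).

Lemma Gam_first_kind i x : U x ->
  Ga i x = 2^-1 *: (first_kind i x *m invmx (g x)).
Proof.
move=> Ux; apply/matrixP => j k; rewrite GamE !mxE; congr (_ * _).
apply: eq_bigr => l _; rewrite !mxE !partial_mxE mulrC; congr (_ * _).
by rewrite -[in LHS](invgT Ux) mxE.
Qed.

Lemma first_kindE i x : U x -> Ga i x *m g x = 2^-1 *: first_kind i x.
Proof.
by move=> Ux; rewrite Gam_first_kind // -scalemxAl -mulmxA Kg // mulmx1.
Qed.

Lemma smooth_Gam i : smooth_mx U (Ga i).
Proof.
have sF : smooth_mx U (first_kind i).
  have sd k := smooth_partial_mx oU k sg.
  move=> j l; apply: eq_smooth_on (smoothD oU (smoothD oU (sd i j l) (sd j i l))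
    (smoothN oU (sd l i j))) => // x _.
  by rewrite mxE.
have sH : smooth_mx U (fun=> (2^-1)%:M : 'M[R]_n) by exact: smooth_mx_cst.
apply: eq_smooth_mx (smooth_mxM oU sH (smooth_mxM oU sF smooth_G)) => // x Ux.
by rewrite mul_scalar_mx Gam_first_kind.
Qed.

Lemma partial_g_sym i x j k : U x ->
  partial_mx i g x j k = partial_mx i g x k j.
Proof.
move=> Ux; rewrite -[in RHS](trmxK (partial_mx i g x)) mxE -partial_mxT.
suff -> : partial_mx i (fun y => (g y)^T) x = partial_mx i g x by [].
exact: (eq_partial_mx oU i Ux gT).
Qed.

(** Torsion-freeness: the coordinate fields commute. *)
Lemma Gam_sym i j k x : U x -> Ga i x j k = Ga j x i k.
Proof.
move=> Ux; rewrite !Gam_first_kind // [LHS]mxE [RHS]mxE.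
congr (_ * _); rewrite [LHS]mxE [RHS]mxE; apply: eq_bigr => l _; congr (_ * _).
by rewrite !mxE (partial_g_sym l i j Ux) [X in X - _]addrC.
Qed.

(** The metric is parallel: in the sum of a first-kind matrix and its transpose
    only the derivative of g in the direction i survives. *)
Lemma partial_gE i x : U x ->
  partial_mx i g x = Ga i x *m g x + g x *m (Ga i x)^T.
Proof.
move=> Ux.
have -> : g x *m (Ga i x)^T = (Ga i x *m g x)^T by rewrite trmx_mul gT.
rewrite first_kindE //; apply/matrixP => a b; rewrite !mxE.
rewrite [partial_mx i g x b a](partial_g_sym i b a Ux).
by field.
Qed.

Lemma partial_GE i x : U x ->
  partial_mx i G x = - (invmx (g x) *m Ga i x) - (Ga i x)^T *m invmx (g x).
Proof.
move=> Ux.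
have dGg : partial_mx i (fun y => invmx (g y) *m g y) x = 0.
  by rewrite -(partial_mx_cst i (1%:M : 'M[R]_n) x); exact: (eq_partial_mx oU i Ux Kg).
move: dGg; rewrite (partial_mxM i Ux smooth_G sg).
move/(congr1 (mulmx^~ (invmx (g x)))) => /=.
rewrite mul0mx mulmxDl -[X in X + _ = _]mulmxA gK // mulmx1 => /eqP.
rewrite addr_eq0 partial_gE // => /eqP ->.
rewrite mulmxDr mulmxDl !mulmxA Kg // mul1mx.
by rewrite -[X in X + _]mulmxA gK // mulmx1 opprD.
Qed.

(** Curvature of the connection matrices; row k holds the components of
    R(d_i, d_j) d_k.  The sign of the commutator comes from the matrices acting
    on rows. *)
Definition Curv i j x : 'M[R]_n :=
  partial_mx i (Ga j) x - partial_mx j (Ga i) x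
  + Ga j x *m Ga i x - Ga i x *m Ga j x.

Lemma riemannE i j k l x : riemann g i j k l x = Curv i j x k l.
Proof.
rewrite /riemann.
have E p q a b : partial p (christoffel g b q a) x = partial_mx p (Ga q) x a b.
  by rewrite partial_mxE; apply: eq_partial => y; rewrite GamE.
rewrite !E /Curv.
have F a b c d : \sum_p christoffel g p a b x * christoffel g c d p x
    = (Ga a x *m Ga d x) b c.
  by rewrite mxE; apply: eq_bigr => p _; rewrite !GamE.
rewrite sumrB !F !mxE addrA.
by [].
Qed.

Lemma smooth_Curv i j : smooth_mx U (Curv i j).
Proof.
have sG k := smooth_Gam k; have sd k l := smooth_partial_mx oU k (smooth_Gam l).
apply: smooth_mxD => //; last by apply/smooth_mxN/smooth_mxM.
apply: smooth_mxD => //; last exact: smooth_mxM.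
by apply: smooth_mxD => //; exact: smooth_mxN.
Qed.

Lemma CurvC i j x : Curv j i x = - Curv i j x.
Proof. by rewrite /Curv; mx_ring. Qed.

(** This is the equality of the mixed second derivatives of the parallel tensor
    g. *)
Lemma Curv_skew i j x : U x ->
  Curv i j x *m g x + g x *m (Curv i j x)^T = 0.
Proof.
move=> Ux; have sG k := smooth_Gam k.
have dd k l : partial_mx k (partial_mx l g) x =
    partial_mx k (Ga l) x *m g x + Ga l x *m (Ga k x *m g x + g x *m (Ga k x)^T)
    + ((Ga k x *m g x + g x *m (Ga k x)^T) *m (Ga l x)^T
       + g x *m (partial_mx k (Ga l) x)^T).
  rewrite (eq_partial_mx oU k Ux (partial_gE l)) (partial_mxD k Ux); last 2 first.
  - exact: smooth_mxM.
  - by apply: smooth_mxM => //; exact: smooth_mxT.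
  rewrite (partial_mxM k Ux (sG l) sg) (partial_mxM k Ux sg (smooth_mxT oU (sG l))).
  by rewrite partial_mxT partial_gE.
have := partial_mxC oU i j Ux sg; rewrite !dd => /eqP; rewrite -subr_eq0 => /eqP E.
rewrite -[RHS]E /Curv !(trmxD, trmxN, trmx_mul).
by mx_ring.
Qed.

Definition Ric x : 'M[R]_n := \matrix_(k, a) \sum_j Curv j k x a j.

Definition scal x : R := \tr (invmx (g x) *m Ric x).

Definition nablaRic i x : 'M[R]_n :=
  partial_mx i Ric x - Ga i x *m Ric x - Ric x *m (Ga i x)^T.

(** Covariant derivative of the curvature as an endomorphism of the tangent
    bundle, disregarding its two form indices; the latter are taken into account
    by [nablaCurv]. *)
Definition DCurv i j k x : 'M[R]_n :=
  partial_mx i (Curv j k) x - Ga i x *m Curv j k x + Curv j k x *m Ga i x.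

Definition nablaCurv i j k x : 'M[R]_n := DCurv i j k x
  - \sum_p Ga i x j p *: Curv p k x - \sum_p Ga i x k p *: Curv j p x.

(** All terms cancel in pairs, by symmetry of second derivatives. *)
Lemma DCurv_cyc i j k x : U x ->
  DCurv i j k x + DCurv j k i x + DCurv k i j x = 0.
Proof.
move=> Ux; have sG l := smooth_Gam l; have sd k' l := smooth_partial_mx oU k' (sG l).
have dC a b c : partial_mx a (Curv b c) x =
    partial_mx a (partial_mx b (Ga c)) x - partial_mx a (partial_mx c (Ga b)) x
    + (partial_mx a (Ga c) x *m Ga b x + Ga c x *m partial_mx a (Ga b) x)
    - (partial_mx a (Ga b) x *m Ga c x + Ga b x *m partial_mx a (Ga c) x).
  have sB := smooth_mxN oU (sd c b); have sA := smooth_mxD oU (sd b c) sB.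
  have sM p q := smooth_mxM oU (sG p) (sG q).
  rewrite /Curv (partial_mxD a Ux (smooth_mxD oU sA (sM c b)) (smooth_mxN oU (sM b c))).
  rewrite (partial_mxD a Ux sA (sM c b)) (partial_mxD a Ux (sd b c) sB).
  rewrite !(partial_mxN a Ux) //.
  by rewrite (partial_mxM a Ux (sG c) (sG b)) (partial_mxM a Ux (sG b) (sG c)).
rewrite /DCurv !dC.
rewrite (partial_mxC oU i j Ux (sG k)) (partial_mxC oU i k Ux (sG j)).
rewrite (partial_mxC oU j k Ux (sG i)) /Curv.
by mx_ring.
Qed.

Lemma nablaCurvE i j k x : nablaCurv i j k x =
  DCurv i j k x - \sum_p Ga i x j p *: Curv p k x
                + \sum_p Ga i x k p *: Curv p j x.
Proof.
rewrite /nablaCurv; congr (_ + _); rewrite -sumrN.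
by apply: eq_bigr => p _; rewrite [Curv j p x]CurvC scalerN opprK.
Qed.

Lemma nablaCurvC i j k x : U x -> nablaCurv i k j x = - nablaCurv i j k x.
Proof.
move=> Ux; suff E : DCurv i k j x = - DCurv i j k x.
  by rewrite !nablaCurvE E -addrA -opprB opprB !opprD opprK addrA addrAC.
rewrite /DCurv (eq_partial_mx oU i Ux (fun y _ => CurvC j k y)).
rewrite (partial_mxN i Ux (smooth_Curv j k)) CurvC.
by move: (Curv j k x) => C; mx_ring.
Qed.

(** Second Bianchi identity: the terms correcting for the form indices cancel
    because the connection is torsion-free. *)
Lemma nablaCurv_cyc i j k x : U x ->
  nablaCurv i j k x + nablaCurv j k i x + nablaCurv k i j x = 0.
Proof.
move=> Ux; pose S a b c := \sum_p Ga a x b p *: Curv p c x.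
have SC a b c : S a b c = S b a c.
  by apply: eq_bigr => p _; rewrite Gam_sym.
rewrite !nablaCurvE -!/(S _ _ _) -[RHS](DCurv_cyc i j k Ux) (SC j i) (SC k i) (SC k j).
move: (DCurv i j k x) (DCurv j k i x) (DCurv k i j x) (S i j k) (S i k j) (S j k i).
by move=> A B C D E F; mx_ring.
Qed.

(** In the contraction of an endomorphism index with a form index the connection
    terms of these two indices cancel; those of the other two remain. *)
Lemma nablaCurv_contract i k a x : U x ->
  \sum_j nablaCurv i j k x a j = nablaRic i x k a.
Proof.
move=> Ux; have sC j l := smooth_Curv j l.
have nE j : nablaCurv i j k x a j = partial i (fun y => Curv j k y a j) x
    - \sum_p Ga i x a p * Curv j k x p j + \sum_p Curv j k x a p * Ga i x p j
    - \sum_p Ga i x j p * Curv p k x a j - \sum_p Ga i x k p * Curv j p x a j.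
  rewrite -partial_mxE /nablaCurv /DCurv !(addE, oppE) !mulE !summxE.
  by congr (_ - _ - _); apply: eq_bigr => p _; rewrite scaleE.
under eq_bigr => j _ do rewrite nE.
rewrite !(sumrB, big_split) /=.
have -> : \sum_j partial i (fun y => Curv j k y a j) x = partial_mx i Ric x k a.
  rewrite partial_mxE -partial_sum; last by move=> j; exact: (smooth_mx_diff _ _ (sC j k) Ux).
  by apply: eq_partial => y; rewrite mxE.
have -> : \sum_j \sum_p Ga i x j p * Curv p k x a j =
    \sum_j \sum_p Curv j k x a p * Ga i x p j.
  by rewrite exchange_big; do 2 apply: eq_bigr => ? _; rewrite mulrC.
have -> : \sum_j \sum_p Ga i x k p * Curv j p x a j = (Ga i x *m Ric x) k a.
  rewrite exchange_big mulE; apply: eq_bigr => p _.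
  by rewrite -mulr_sumr [Ric x p a]mxE.
have -> : \sum_j \sum_p Ga i x a p * Curv j k x p j = (Ric x *m (Ga i x)^T) k a.
  rewrite exchange_big mulE; apply: eq_bigr => p _.
  by rewrite -mulr_sumr [Ric x k p]mxE [RHS]mulrC trE.
by rewrite /nablaRic !(addE, oppE); ring.
Qed.

(** Skew-adjointness with respect to the metric. *)
Definition skew x (X : 'M[R]_n) := X *m g x + g x *m X^T = 0.

Lemma skewD x X Y : skew x X -> skew x Y -> skew x (X + Y).
Proof.
by move=> sX sY; rewrite /skew trmxD mulmxDl mulmxDr addrACA sX sY addr0.
Qed.

Lemma skewN x X : skew x X -> skew x (- X).
Proof. by move=> sX; rewrite /skew trmxN mulNmx mulmxN -opprD sX oppr0. Qed.

Lemma skewZ x (c : R) X : skew x X -> skew x (c *: X).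
Proof.
move=> sX; rewrite /skew (_ : (c *: X)^T = c *: X^T); last first.
  by apply/matrixP => a b; rewrite !mxE.
by rewrite -scalemxAl -scalemxAr -scalerDr sX scaler0.
Qed.

Lemma skew_sum x (I : finType) (X : I -> 'M[R]_n) :
  (forall p, skew x (X p)) -> skew x (\sum_p X p).
Proof.
move=> sX; elim/big_ind: _ => //; last exact: skewD.
by rewrite /skew trmx0 mul0mx mulmx0 addr0.
Qed.

Lemma skew_raise x X : U x -> skew x X ->
  (invmx (g x) *m X)^T = - (invmx (g x) *m X).
Proof.
move=> Ux /(congr1 (mulmx (invmx (g x)))) /(congr1 (mulmx^~ (invmx (g x)))) /=.
rewrite mulmx0 mul0mx mulmxDr mulmxDl !mulmxA Kg // mul1mx -[X in X + _]mulmxA.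
rewrite gK // mulmx1 trmx_mul invgT // => /eqP.
by rewrite addrC addr_eq0 => /eqP.
Qed.

Lemma DCurv_skew i j k x : U x -> skew x (DCurv i j k x).
Proof.
move=> Ux; have sC := smooth_Curv j k; have sCT := smooth_mxT oU sC.
have := partial_mx_cst i (0 : 'M[R]_n) x.
rewrite -(eq_partial_mx oU i Ux (@Curv_skew j k)).
rewrite (partial_mxD i Ux (smooth_mxM oU sC sg) (smooth_mxM oU sg sCT)).
rewrite (partial_mxM i Ux sC sg) (partial_mxM i Ux sg sCT) partial_mxT partial_gE //.
have := Curv_skew j k Ux; rewrite /skew /DCurv.
move: (Curv j k x) (Ga i x) (partial_mx i _ x) (g x) => C P D m E1 E2.
rewrite !(trmxD, trmxN, trmx_mul).
have E3 : P *m (C *m m + m *m C^T) + (C *m m + m *m C^T) *m P^T = 0.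
  by rewrite E1 mulmx0 mul0mx addr0.
rewrite -[RHS](subrr (0 : 'M[R]_n)) -[X in _ = X - _]E2 -[X in _ = _ - X]E3.
by mx_ring.
Qed.

Lemma nablaCurv_skew i j k x : U x -> skew x (nablaCurv i j k x).
Proof.
move=> Ux; have sC a b := Curv_skew a b Ux.
apply: skewD; first apply: skewD; first exact: DCurv_skew.
  by apply/skewN/skew_sum => p; exact: skewZ.
by apply/skewN/skew_sum => p; exact: skewZ.
Qed.

Definition divRic i x : R := \sum_j \sum_a invmx (g x) j a * nablaRic j x i a.

Lemma smooth_Ric : smooth_mx U Ric.
Proof.
move=> k a.
apply: eq_smooth_on (smooth_sum _ oU (fun j => smooth_Curv j k a j)) => // x _.
by rewrite mxE.
Qed.

Lemma partial_scal i x : U x ->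
  partial i scal x = \tr (invmx (g x) *m nablaRic i x).
Proof.
move=> Ux; have sM := smooth_mxM oU smooth_G smooth_Ric.
have -> : partial i scal x = \tr (partial_mx i (fun y => invmx (g y) *m Ric y) x).
  rewrite /mxtrace; under [RHS]eq_bigr => j _ do rewrite partial_mxE.
  by rewrite -partial_sum // => j; exact: (smooth_mx_diff _ _ sM Ux).
rewrite (partial_mxM i Ux smooth_G smooth_Ric) partial_GE // /nablaRic.
rewrite !(mulmxDl, mulmxDr, mulNmx, mulmxN) !(mxtraceD, raddfN) /=.
have cyc : \tr ((Ga i x)^T *m invmx (g x) *m Ric x) =
    \tr (invmx (g x) *m Ric x *m (Ga i x)^T) by rewrite -mulmxA mxtrace_mulC.
by rewrite !mulmxA cyc; ring.
Qed.

Lemma tr_contract x (X : 'M[R]_n) : U x ->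
  \tr (invmx (g x) *m X) = \sum_k \sum_a invmx (g x) k a * X k a.
Proof.
move=> Ux; rewrite /mxtrace; under eq_bigr => k _ do rewrite mulE.
rewrite exchange_big; do 2 apply: eq_bigr => ? _.
by rewrite -{1}(invgT Ux) trE.
Qed.

(** Contracted second Bianchi identity.  Tracing the cyclic sum over the index j
    gives two derivatives of Ric and the divergence of the curvature; after a
    second trace the latter is a divergence of Ric too, by skewness of the
    curvature. *)
Lemma partial_scal_divRic i x : U x -> partial i scal x = divRic i x *+ 2.
Proof.
move=> Ux; rewrite partial_scal //.
rewrite tr_contract //.
have B k a : nablaRic i x k a = nablaRic k x i a - \sum_j nablaCurv j k i x a j.
  rewrite -!nablaCurv_contract //.
  have E j : nablaCurv i j k x a j =
      nablaCurv k j i x a j - nablaCurv j k i x a j.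
    have := nablaCurv_cyc i j k Ux.
    rewrite (nablaCurvC k j i Ux).
    move: (nablaCurv i j k x) (nablaCurv j k i x) (nablaCurv k j i x) => X Y Z.
    by move/matrixP => /(_ a j); rewrite !addE oppE zeroE; lra.
  by rewrite -sumrB; apply: eq_bigr => j _; exact: E.
have -> : \sum_k \sum_a invmx (g x) k a * nablaRic i x k a =
    divRic i x - \sum_k \sum_a invmx (g x) k a * \sum_j nablaCurv j k i x a j.
  rewrite -sumrB; apply: eq_bigr => k _; rewrite -sumrB; apply: eq_bigr => a _.
  by rewrite B mulrBr.
have swap k j : \sum_a invmx (g x) k a * nablaCurv j k i x a j =
    - \sum_a invmx (g x) j a * nablaCurv j k i x a k.
  by rewrite -!mulE -[LHS]trE (skew_raise Ux (nablaCurv_skew j k i Ux)) oppE.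
suff -> : \sum_k \sum_a invmx (g x) k a * (\sum_j nablaCurv j k i x a j) =
    - divRic i x by rewrite opprK mulr2n.
transitivity (\sum_k \sum_j \sum_a invmx (g x) k a * nablaCurv j k i x a j).
  apply: eq_bigr => k _; rewrite exchange_big; apply: eq_bigr => a _.
  by rewrite mulr_sumr.
under eq_bigr => k _ do under eq_bigr => j _ do rewrite swap.
rewrite exchange_big -sumrN; apply: eq_bigr => j _.
rewrite sumrN exchange_big; congr (- _); apply: eq_bigr => a _.
by rewrite -mulr_sumr nablaCurv_contract.
Qed.

Section Soliton.
Variables (f : 'rV[R]_n -> R) (lambda c : R).
Hypothesis sf : smooth_on U f.

Local Notation w := (df_col f).

Lemma smooth_df : smooth_mx U w.
Proof.
move=> k o; apply: eq_smooth_on (smooth_partial k sf) => // x _.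
by rewrite (ord1 o) df_colE.
Qed.

(** Covariant derivative of df in the direction i, that is row i of the Hessian. *)
Definition hess_col i x : 'cV[R]_n := partial_mx i w x - Ga i x *m w x.

Definition Hess x : 'M[R]_n := \matrix_(i, j) hess_col i x j 0.

Lemma partial_dfC i j x : U x -> partial_mx i w x j 0 = partial_mx j w x i 0.
Proof.
move=> Ux; have E k l : partial_mx k w x l 0 = partial k (partial l f) x.
  by rewrite partial_mxE; apply: eq_partial => y; rewrite df_colE.
apply: (etrans (E i j)); apply: (etrans (partialC i j oU sf Ux)).
by symmetry; exact: E.
Qed.

Lemma Hess_sym x : U x -> (Hess x)^T = Hess x.
Proof.
move=> Ux; apply/matrixP => i j; rewrite trE [LHS]mxE [RHS]mxE !addE !oppE.
rewrite partial_dfC // !mulE; congr (_ - _); apply: eq_bigr => k _.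
by rewrite Gam_sym.
Qed.

Lemma Hess_colE x i j : U x -> Hess x j i = hess_col i x j 0.
Proof. by move=> Ux; rewrite -(Hess_sym Ux) trE [LHS]mxE. Qed.

Lemma smooth_hess_col i : smooth_mx U (hess_col i).
Proof.
apply: smooth_mxD => //; first exact/smooth_partial_mx/smooth_df.
by apply: smooth_mxN => //; apply: smooth_mxM => //; [exact: smooth_Gam|exact: smooth_df].
Qed.

Lemma smooth_Hess : smooth_mx U Hess.
Proof.
move=> i j; apply: eq_smooth_on (smooth_hess_col i j 0) => // x _.
by rewrite [RHS]mxE.
Qed.

Definition nablaHess i x : 'M[R]_n :=
  partial_mx i Hess x - Ga i x *m Hess x - Hess x *m (Ga i x)^T.

Lemma nablaHessE i j k x : nablaHess i x j k =
  (partial_mx i (hess_col j) x - Ga i x *m hess_col j x) k 0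
  - \sum_p Ga i x j p * hess_col p x k 0.
Proof.
rewrite /nablaHess !(addE, oppE).
have -> : partial_mx i Hess x j k = partial_mx i (hess_col j) x k 0.
  by rewrite !partial_mxE; apply: eq_partial => y; rewrite [LHS]mxE.
have -> : (Ga i x *m Hess x) j k = \sum_p Ga i x j p * hess_col p x k 0.
  by rewrite mulE; apply: eq_bigr => p _; rewrite [Hess _ _ _]mxE.
have -> : (Hess x *m (Ga i x)^T) j k = (Ga i x *m hess_col j x) k 0.
  by rewrite !mulE; apply: eq_bigr => p _; rewrite trE [Hess _ _ _]mxE mulrC.
by rewrite addrAC.
Qed.

(** Ricci identity: the corrections for the index on which the curvature does not
    act cancel because the connection is torsion-free. *)
Lemma nablaHess_comm i j k x : U x ->
  nablaHess i x j k - nablaHess j x i k = - (Curv i j x *m w x) k 0.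
Proof.
move=> Ux; have sd a := smooth_partial_mx oU a smooth_df.
have dh a b : partial_mx a (hess_col b) x = partial_mx a (partial_mx b w) x
    - (partial_mx a (Ga b) x *m w x + Ga b x *m partial_mx a w x).
  have sM := smooth_mxM oU (smooth_Gam b) smooth_df.
  rewrite (partial_mxD a Ux (sd b) (smooth_mxN oU sM)) (partial_mxN a Ux sM).
  by rewrite (partial_mxM a Ux (smooth_Gam b) smooth_df).
rewrite !nablaHessE.
have -> : \sum_p Ga j x i p * hess_col p x k 0 = \sum_p Ga i x j p * hess_col p x k 0.
  by apply: eq_bigr => p _; rewrite Gam_sym.
have E : partial_mx i (hess_col j) x - Ga i x *m hess_col j x
    - (partial_mx j (hess_col i) x - Ga j x *m hess_col i x) =
    - (Curv i j x *m w x).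
  rewrite !dh (partial_mxC oU i j Ux smooth_df) /hess_col /Curv.
  by mx_ring.
rewrite -[RHS]oppE -E.
move: (_ - Ga i x *m _) (_ - Ga j x *m _) (\sum_p _) => X Y s.
by rewrite addE oppE; ring.
Qed.

Hypothesis soliton : forall x, U x -> Ric x + Hess x = lambda *: g x.
Hypothesis scal_cst : forall x, U x -> scal x = c.

Lemma RicE x : U x -> Ric x = lambda *: g x - Hess x.
Proof. by move=> /soliton <-; rewrite addrK. Qed.

Lemma Ric_sym x : U x -> (Ric x)^T = Ric x.
Proof.
move=> Ux; have E a b : g x a b = g x b a by rewrite -{1}(gT Ux) trE.
apply/matrixP => a b; rewrite trE RicE // !(addE, oppE, scaleE) E.
by rewrite -{1}(Hess_sym Ux) trE.
Qed.

Lemma nablaRicE i x : U x -> nablaRic i x = - nablaHess i x.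
Proof.
move=> Ux; rewrite /nablaRic /nablaHess RicE //.
have sl : smooth_mx U (fun=> lambda%:M : 'M[R]_n) by exact: smooth_mx_cst.
have sM := smooth_mxM oU sl sg; have sN := smooth_mxN oU smooth_Hess.
have -> : partial_mx i Ric x = lambda *: partial_mx i g x - partial_mx i Hess x.
  rewrite -mul_scalar_mx -(partial_mxN i Ux smooth_Hess).
  have -> : lambda%:M *m partial_mx i g x = partial_mx i (fun y => lambda%:M *m g y) x.
    by rewrite (partial_mxM i Ux sl sg) partial_mx_cst mul0mx add0r.
  rewrite -(partial_mxD i Ux sM sN); apply: (eq_partial_mx oU i Ux) => y Uy.
  by rewrite mul_scalar_mx RicE.
rewrite partial_gE //.
move: (Hess x) (partial_mx i _ x) (Ga i x) (g x) => H D C m.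
rewrite mulmxBr mulmxBl -scalemxAr -scalemxAl.
by mx_ring.
Qed.

Lemma partial_scal0 i x : U x -> partial i scal x = 0.
Proof.
move=> Ux; rewrite -(partial_cst i c x); apply: near_eq_partial.
by apply: filterS (open_nbhs_nbhs (conj oU Ux)) => y /scal_cst.
Qed.

Lemma divRic0 i x : U x -> divRic i x = 0.
Proof.
move=> Ux; have := partial_scal_divRic i Ux.
by rewrite partial_scal0 // => /esym/eqP; rewrite mulrn_eq0 => /eqP.
Qed.

Definition gradf x : 'cV[R]_n := invmx (g x) *m w x.

(** Tracing the commutation identity turns the curvature term into
    Ric(grad f) and the left-hand side into derivatives of the constant scalar
    curvature. *)
Lemma Ric_gradf x : U x -> Ric x *m gradf x = 0.
Proof.
move=> Ux; apply/matrixP => i o; rewrite (ord1 o) zeroE {o}.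
have zero : \sum_j \sum_k invmx (g x) j k * (Curv i j x *m w x) k 0 = 0.
  transitivity (\tr (invmx (g x) *m nablaRic i x) - divRic i x); last first.
    by rewrite -partial_scal // partial_scal0 // divRic0 // subrr.
  rewrite tr_contract // -sumrB; apply: eq_bigr => j _.
  rewrite -sumrB; apply: eq_bigr => k _; rewrite -mulrBr; congr (_ * _).
  rewrite !nablaRicE // !oppE -opprD addrC.
  have := nablaHess_comm i j k Ux.
  by move: (_ k 0) (nablaHess i x j k) (nablaHess j x i k) => p q r; lra.
rewrite -zero mulE.
have raise j l : \sum_k invmx (g x) j k * Curv i j x k l =
    - \sum_k invmx (g x) l k * Curv i j x k j.
  by rewrite -!mulE -[LHS]trE (skew_raise Ux (Curv_skew i j Ux)) oppE.
have step j : \sum_k invmx (g x) j k * (Curv i j x *m w x) k 0 =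
    \sum_k Curv j i x k j * gradf x k 0.
  transitivity (\sum_l (\sum_k invmx (g x) j k * Curv i j x k l) * w x l 0).
    under eq_bigr => k _ do rewrite mulE mulr_sumr.
    rewrite exchange_big; apply: eq_bigr => l _; rewrite mulr_suml.
    by apply: eq_bigr => k _; rewrite mulrA.
  under eq_bigr => l _ do rewrite raise -sumrN mulr_suml.
  rewrite exchange_big; apply: eq_bigr => k _; rewrite mulE mulr_sumr.
  apply: eq_bigr => l _; rewrite -{1}(invgT Ux) trE [Curv j i x]CurvC oppE.
  by ring.
under [RHS]eq_bigr => j _ do rewrite step.
rewrite exchange_big; apply: eq_bigr => k _.
by rewrite -mulr_suml; congr (_ * _); rewrite mxE.
Qed.

Lemma nablaRic_sym i x a b : U x -> nablaRic i x a b = nablaRic i x b a.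
Proof.
move=> Ux; suff E : (nablaRic i x)^T = nablaRic i x by rewrite -{1}E trE.
rewrite /nablaRic !(trmxD, trmxN) !trmx_mul trmxK Ric_sym // -partial_mxT.
rewrite (eq_partial_mx oU i Ux Ric_sym).
by rewrite -!addrA; congr (_ + _); rewrite addrC.
Qed.

(** Covariant derivative of the identity Ric(grad f) = 0. *)
Lemma nabla_Ric_gradf i x : U x ->
  nablaRic i x *m gradf x + Ric x *m (invmx (g x) *m hess_col i x) = 0.
Proof.
move=> Ux; have sM := smooth_mxM oU smooth_G smooth_df.
have E := partial_mxM i Ux smooth_Ric sM.
have := Ric_gradf Ux; have := partial_mx_cst i (0 : 'cV[R]_n) x.
rewrite -(eq_partial_mx oU i Ux Ric_gradf) E (partial_mxM i Ux smooth_G smooth_df).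
rewrite partial_GE // /nablaRic /hess_col /gradf.
move: (partial_mx i Ric x) (partial_mx i w x) (Ric x) (invmx (g x)) (Ga i x) (w x).
move=> D d P K C v E1 E2.
have E3 : C *m (P *m (K *m v)) = 0 by rewrite E2 mulmx0.
rewrite -[RHS](subrr (0 : 'cV[R]_n)) -[X in _ = X - _]E1 -[X in _ = _ - X]E3.
by mx_ring.
Qed.

(** This is |grad f|^2, computed as the value of df on grad f. *)
Definition energy x : R := ((w x)^T *m gradf x) 0 0.

(** Half the derivative of |grad f|^2 is Hess(grad f) = lambda df - Ric(grad f). *)
Lemma partial_energy i x : U x -> partial i energy x = lambda * partial i f x *+ 2.
Proof.
move=> Ux; have sT := smooth_mxT oU smooth_df.
have sM := smooth_mxM oU smooth_G smooth_df.
have H : ((hess_col i x)^T *m gradf x) 0 0 = lambda * partial i f x.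
  transitivity ((Hess x *m gradf x) i 0).
    by rewrite [LHS]mulE [RHS]mulE; apply: eq_bigr => b _; rewrite trE [Hess x i b]mxE.
  have -> : Hess x = lambda *: g x - Ric x by rewrite RicE // opprB addrC subrK.
  rewrite mulmxBl Ric_gradf // subr0 -scalemxAl /gradf mulmxA gK // mul1mx.
  by rewrite scaleE df_colE.
have HT : ((w x)^T *m (invmx (g x) *m hess_col i x)) 0 0 = lambda * partial i f x.
  by rewrite -H -[LHS]trE !trmx_mul trmxK invgT // mulmxA.
rewrite mulr2n -{1}H -HT -addE -(partial_mxE i (fun y => (w y)^T *m gradf y)).
rewrite (partial_mxM i Ux sT sM) (partial_mxM i Ux smooth_G smooth_df).
rewrite partial_mxT partial_GE // /gradf /hess_col.
move: (partial_mx i w x) (invmx (g x)) (Ga i x) (w x) => d P C v.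
suff -> : (d - C *m v)^T *m (P *m v) + v^T *m (P *m (d - C *m v)) =
    d^T *m (P *m v) + v^T *m ((- (P *m C) - C^T *m P) *m v + P *m d) by [].
by rewrite !(trmxD, trmxN, trmx_mul); mx_ring.
Qed.

(** Where df vanishes, the derivative of Ric(grad f) = 0 reads Ric G Hess = 0. *)
Lemma critical_Hess x : U x -> w x = 0 ->
  Hess x *m invmx (g x) *m Hess x = lambda *: Hess x.
Proof.
move=> Ux w0.
have Rh i : Ric x *m (invmx (g x) *m hess_col i x) = 0.
  by have := nabla_Ric_gradf i Ux; rewrite /gradf w0 !mulmx0 add0r.
have RH : Ric x *m invmx (g x) *m Hess x = 0.
  apply/matrixP => a i; rewrite zeroE -[RHS](zeroE a (0 : 'I_1)) -(Rh i).
  rewrite mulmxA [LHS]mulE [RHS]mulE; apply: eq_bigr => b _.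
  by rewrite Hess_colE.
move: RH; rewrite RicE // mulmxBl mulmxBl -scalemxAl gK // -scalemxAl mul1mx.
by move/eqP; rewrite subr_eq0 => /eqP.
Qed.

Lemma tr_G_Hess x : U x -> \tr (invmx (g x) *m Hess x) = n%:R * lambda - c.
Proof.
move=> Ux; rewrite -(scal_cst Ux) /scal RicE // mulmxBr raddfB /= -scalemxAr Kg //.
by rewrite mxtraceZ mxtrace1; ring.
Qed.

(** Divergence of the vanishing field Ric(grad f). *)
Lemma tr_Hess_Ric x : U x ->
  \tr (invmx (g x) *m (Hess x *m invmx (g x) *m Ric x)) = 0.
Proof.
move=> Ux; rewrite tr_contract //.
have E k a : (Hess x *m invmx (g x) *m Ric x) k a =
    - \sum_b nablaRic k x a b * gradf x b 0.
  have := congr1 (fun Y : 'cV[R]_n => Y a 0) (nabla_Ric_gradf k Ux).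
  rewrite addE zeroE [X in X + _]mulE => /eqP; rewrite addrC addr_eq0 => /eqP <-.
  rewrite -[LHS]trE !trmx_mul invgT // Ric_sym // Hess_sym //.
  by rewrite !mulmxA [LHS]mulE [RHS]mulE; apply: eq_bigr => b _; rewrite Hess_colE.
under eq_bigr => k _ do under eq_bigr => a _ do rewrite E mulrN mulr_sumr.
under eq_bigr => k _ do rewrite sumrN exchange_big /=.
rewrite sumrN exchange_big big1 ?oppr0 // => b _.
transitivity (divRic b x * gradf x b 0); last by rewrite divRic0 // mul0r.
rewrite mulr_suml; apply: eq_bigr => k _; rewrite mulr_suml; apply: eq_bigr => a _.
by rewrite mulrA (nablaRic_sym k b a Ux).
Qed.

(** The hypotheses say that the coordinate expression y of a curve has velocity v
    and satisfies the geodesic equation, but only at one time t: on a manifold a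
    chart is valid along a curve only locally in time. *)
Section AlongGeodesic.
Variables (y v : R -> 'rV[R]_n) (t : R).
Hypothesis Uyt : U (y t).
Hypothesis dy : is_derive_mx t y (v t).
Let Gav := \sum_l v t 0 l *: Ga l (y t).
Hypothesis dv : is_derive_mx t v (- (v t *m Gav)).

Lemma is_derive_mx_along p q (X : 'rV[R]_n -> 'M[R]_(p, q)) : smooth_mx U X ->
  is_derive_mx t (fun s => X (y s)) (\sum_l v t 0 l *: partial_mx l X (y t)).
Proof.
move=> sX a b; have dX := smooth_mx_diff a b sX Uyt.
have := chain_curve dX (fun k => dy 0 k).
have -> : \sum_k partial k (fun z => X z a b) (y t) * v t 0 k =
    (\sum_l v t 0 l *: partial_mx l X (y t)) a b => //.
by rewrite summxE; apply: eq_bigr => k _; rewrite scaleE partial_mxE mulrC.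
Qed.

Lemma is_derive_f_along :
  is_derive t 1 (fun s => f (y s)) ((v t *m w (y t)) 0 0).
Proof.
have := chain_curve (smooth_differentiable sf Uyt) (fun k => dy 0 k).
have -> // : \sum_k partial k f (y t) * v t 0 k = (v t *m w (y t)) 0 0.
by rewrite mulE; apply: eq_bigr => k _; rewrite df_colE mulrC.
Qed.

Lemma is_derive_energy_along :
  is_derive t 1 (fun s => energy (y s)) (lambda * (v t *m w (y t)) 0 0 *+ 2).
Proof.
have sG' := smooth_mxM oU smooth_G smooth_df.
have sE := smooth_mxM oU (smooth_mxT oU smooth_df) sG'.
have := chain_curve (smooth_mx_diff 0 0 sE Uyt) (fun k => dy 0 k).
have -> // : \sum_k partial k energy (y t) * v t 0 k =
    lambda * (v t *m w (y t)) 0 0 *+ 2.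
rewrite mulE mulr_sumr -sumrMnl; apply: eq_bigr => k _.
rewrite (partial_energy k Uyt) [w (y t) k 0]df_colE.
by move: (partial k f (y t)) (v t 0 k) => a b; ring.
Qed.

Lemma is_derive_speed_along :
  is_derive t 1 (fun s => (v s *m g (y s) *m (v s)^T) 0 0) 0.
Proof.
have := is_derive_mxM (is_derive_mxM dv (is_derive_mx_along sg)) (is_derive_mxT dv).
have -> : \sum_l v t 0 l *: partial_mx l g (y t) = Gav *m g (y t) + g (y t) *m Gav^T.
  rewrite /Gav linear_sum mulmx_suml mulmx_sumr -big_split; apply: eq_bigr => l _ /=.
  by rewrite partial_gE // scalerDr scalemxAl linearZ /= scalemxAr.
move/(_ 0 0); suff -> : (- (v t *m Gav) *m g (y t) +
    v t *m (Gav *m g (y t) + g (y t) *m Gav^T)) *m (v t)^T +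
    v t *m g (y t) *m (- (v t *m Gav))^T = 0 by rewrite zeroE.
rewrite trmxN trmx_mul; move: Gav (g (y t)) (v t) => C m u.
by mx_ring.
Qed.

Lemma is_derive_df_along :
  is_derive t 1 (fun s => (v s *m w (y s)) 0 0)
    ((v t *m Hess (y t) *m (v t)^T) 0 0).
Proof.
have := is_derive_mxM dv (is_derive_mx_along smooth_df).
have -> : \sum_l v t 0 l *: partial_mx l w (y t) =
    Hess (y t) *m (v t)^T + Gav *m w (y t).
  have -> : Hess (y t) *m (v t)^T = \sum_l v t 0 l *: hess_col l (y t).
    apply/matrixP => a b; rewrite (ord1 b) mulE summxE; apply: eq_bigr => l _.
    by rewrite trE scaleE mulrC Hess_colE.
  rewrite /Gav mulmx_suml -big_split; apply: eq_bigr => l _ /=.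
  by rewrite -scalemxAl -scalerDr /hess_col subrK.
move/(_ 0 0); suff -> : - (v t *m Gav) *m w (y t) +
    v t *m (Hess (y t) *m (v t)^T + Gav *m w (y t)) =
    v t *m Hess (y t) *m (v t)^T by [].
move: Gav (w (y t)) (Hess (y t)) (v t) => C m H u.
by mx_ring.
Qed.

End AlongGeodesic.

End Soliton.

End Connection.

Arguments Ric {R n} g x.
Arguments scal {R n} g x.
Arguments Curv {R n} g i j x.
Arguments Hess {R n} g f x.
Arguments gradf {R n} g f x.
Arguments energy {R n} g f x.

Lemma ricciE (R : realType) n (g : 'rV[R]_n -> 'M[R]_n) x : ricci g x = Ric g x.
Proof.
apply/matrixP => j k; rewrite [LHS]mxE [RHS]mxE; apply: eq_bigr => i _.
exact: riemannE.
Qed.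

Lemma hessianE (R : realType) n (g : 'rV[R]_n -> 'M[R]_n) h x :
  hessian g h x = Hess g h x.
Proof.
apply/matrixP => i j; rewrite [LHS]mxE [RHS]mxE addE oppE mulE; congr (_ - _).
  by rewrite partial_mxE; apply: eq_partial => y; rewrite df_colE.
by apply: eq_bigr => k _; rewrite GamE df_colE.
Qed.

Lemma scalar_curvatureE (R : realType) n (U : set 'rV[R]_n)
    (g : 'rV[R]_n -> 'M[R]_n) x : (forall x, U x -> (g x)^T = g x) -> U x ->
  scalar_curvature g x = scal g x.
Proof. by move=> gT Ux; rewrite /scal (tr_contract gT) // -ricciE. Qed.

(** * A Gronwall argument *)

Section Gronwall.
Context {R : realType}.
Variables (z dz : R -> R).
Hypothesis zP : forall t : R, is_derive t 1 z (dz t).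
Hypothesis z_ge0 : forall t, 0 <= z t.

(** [z s * expR (- L * s)] is nonincreasing on the interval. *)
Lemma gronwall_forward (L a b : R) : a <= b -> z a = 0 ->
  (forall s, a <= s <= b -> `|dz s| <= L * z s) -> z b = 0.
Proof.
rewrite le_eqVlt => /orP[/eqP<-//|ab] za bnd.
pose y s := z s * expR (- L * s).
have yP (s : R) : is_derive s 1 y ((dz s - L * z s) * expR (- L * s)).
  have e1 : is_derive s 1 (fun s => expR (- L * s)) (expR (- L * s) * - L).
    have -> : (fun s => expR (- L * s)) = expR \o ( *%R (- L)) by [].
    apply: is_derive1_comp; rewrite (_ : *%R (- L) = - L \*: id) //.
    by apply: is_derive_eq; rewrite [LHS]mulr1.
  have := is_deriveM (zP s) e1; rewrite -[_ * _]/y.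
  move/is_derive_eq; apply; rewrite /GRing.scale/=; ring.
have [s|s sab yE] := @MVT R y _ a b ab (fun s _ => yP s).
  apply: derivable_within_continuous => s' _.
  exact: (@ex_derive _ _ _ _ _ _ _ (yP s')).
have : y b <= 0.
  move: yE; rewrite {2}/y za mul0r subr0 => ->.
  rewrite in_itv /= in sab; case/andP: sab => as_ sb.
  have asb : a <= s <= b by rewrite !ltW.
  have /(le_trans (ler_norm _)) dzs := bnd s asb.
  apply: mulr_le0_ge0; last by rewrite subr_ge0 ltW.
  by apply: mulr_le0_ge0; [rewrite subr_le0|exact: expR_ge0].
rewrite /y pmulr_lle0 ?expR_gt0 // => zb.
by apply/eqP; rewrite eq_le zb z_ge0.
Qed.

End Gronwall.

(** The zero set of z is closed by continuity, and open by the one-sided estimate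
    applied forwards and backwards in time. *)
Lemma gronwall_zero (R : realType) (z dz : R -> R) (t0 : R) :
  (forall t : R, is_derive t 1 z (dz t)) -> (forall t, 0 <= z t) -> z t0 = 0 ->
  (forall t : R, exists L : R, \forall s \near t, `|dz s| <= L * z s) ->
  forall t, z t = 0.
Proof.
move=> zP z_ge0 zt0 bnd.
have bwdP (t : R) : is_derive t 1 (fun s => z (- s)) (- dz (- t)).
  have := is_derive1_comp (zP (- t)) (@is_deriveNid _ _ t 1).
  by rewrite mulrN1.
have zc : continuous z.
  move=> t; apply: differentiable_continuous; apply/derivable1_diffP.
  exact: (@ex_derive _ _ _ _ _ _ _ (zP t)).
have conn : connected [set: R] by apply/connected_intervalP => x y _ _ s _.
suff E : [set t | z t = 0] = [set: R].
  by move=> t; have : [set: R] t by []; rewrite -E.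
apply: conn; first by exists t0.
- exists [set t | z t = 0]; last by rewrite setTI.
    rewrite openE => a /= za; have [L /nbhs_ballP[d /= d0 dP]] := bnd a.
    apply/nbhs_ballP; exists d => //= b; rewrite /ball /= => bd.
    have near_ab s : `|a - s| <= `|a - b| -> `|dz s| <= L * z s.
      by move=> sb; apply: dP; rewrite /ball /= (le_lt_trans sb).
    have [ab|ba] := leP a b.
      apply: (gronwall_forward zP z_ge0 ab za (L := L)) => s /andP[as_ sb].
      by apply: near_ab; rewrite !(distrC a) !ger0_norm ?subr_ge0 // lerB.
    have nab : - a <= - b by rewrite lerN2 ltW.
    rewrite -(opprK b); apply: (gronwall_forward bwdP _ nab (L := L)) => // [|s /andP[as_ sb]].
      by rewrite opprK.
    by rewrite normrN; apply: near_ab; rewrite !ger0_norm; lra.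
- exists [set t | z t = 0]; last by rewrite setTI.
  exact: (closed_comp (fun t _ => zc t) (@closed_eq _ 0)).
Qed.

(** * Solitons of constant scalar curvature *)

HB.lock Definition velocity (R : realType) (n : nat) (M : topologicalType)
    (a : chart R n M) (gamma : R -> M) (t : R) : 'rV[R]_n :=
  \row_k derive1 (curve_coord a gamma k) t.

Lemma velocityE (R : realType) n (M : topologicalType) (a : chart R n M)
  (gamma : R -> M) t k : velocity a gamma t 0 k = derive1 (curve_coord a gamma k) t.
Proof. by rewrite velocity.unlock mxE. Qed.

Section Manifold.
Context {R : realType} {n : nat} {M : topologicalType}.
Context {A : smooth_atlas R n M} {g : riemannian_metric A}.
Context {f : M -> R} {lambda c : R}.
Hypothesis sf : smooth_function A f.
Hypothesis sol : forall (i : atlas_index A) (x : 'rV[R]_n), cod (A i) x ->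
  ricci (g i) x + hessian (g i) (f \o bwd (A i)) x = lambda *: g i x.
Hypothesis scal_cst : scalar_curvature_constant g c.

Implicit Types (i j : atlas_index A) (x : 'rV[R]_n) (p : M).
Local Notation f_ i := (f \o bwd (A i)).

Let cod_o i : open (cod (A i)) := @cod_open _ _ _ (A i).

Let g_smooth i : smooth_mx (cod (A i)) (g i).
Proof. by move=> a b; exact: metric_smooth. Qed.

Let g_sym i x : cod (A i) x -> (g i x)^T = g i x.
Proof. exact: metric_sym. Qed.

Let g_pos i x : cod (A i) x ->
  forall v : 'rV[R]_n, v != 0 -> 0 < (v *m g i x *m v^T) 0 0.
Proof. exact: metric_pos. Qed.

Let g_unit i x : cod (A i) x -> g i x \in unitmx.
Proof. by move=> /g_pos; exact: posdef_unitmx. Qed.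

Let soliton_eq i x : cod (A i) x ->
  Ric (g i) x + Hess (g i) (f_ i) x = lambda *: g i x.
Proof. by move=> ix; rewrite -sol // ricciE hessianE. Qed.

Let HessE i x : cod (A i) x ->
  Hess (g i) (f_ i) x = lambda *: g i x - Ric (g i) x.
Proof. by move=> ix; rewrite -(soliton_eq ix) [X in X - _]addrC addrK. Qed.

Let scal_eq i x : cod (A i) x -> scal (g i) x = c.
Proof. by move=> ix; rewrite -(scal_cst ix) (scalar_curvatureE (@g_sym i) ix). Qed.

(** H / lambda is a projection at the critical point, with trace
    n - c / lambda. *)
Lemma critical_point_value i x : lambda != 0 -> cod (A i) x ->
  df_col (f_ i) x = 0 -> exists k : nat, (k <= n)%N /\ c = k%:R * lambda.
Proof.
move=> l0 ix w0.
have HGH := critical_Hess (@cod_o i) (@g_smooth i) (@g_sym i) (@g_unit i) (@sf i)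
  (@soliton_eq i) (@scal_eq i) ix w0.
have trH := tr_G_Hess (@g_unit i) (@soliton_eq i) (@scal_eq i) ix.
pose N := lambda^-1 *: (invmx (g i x) *m Hess (g i) (f_ i) x).
have NN : N *m N = N.
  rewrite /N -scalemxAl -scalemxAr -mulmxA [_ *m (invmx _ *m _)]mulmxA HGH.
  by rewrite -scalemxAr [lambda^-1 *: (lambda *: _)]scalerA mulVf // scale1r.
exists (n - \rank N)%N; split; first exact: leq_subr.
have := mxtrace_idempotent NN; rewrite /N mxtraceZ trH -/N => trN.
rewrite natrB ?rank_leq_row // -trN.
by field.
Qed.

(** For lambda = 0 the Hessian is minus Ric, and tr (Ric Hess) = 0. *)
Lemma steady_scal0 i x : cod (A i) x -> lambda = 0 -> c = 0.
Proof.
move=> ix l0; rewrite -(scal_eq ix); apply: (trace_square_eq0 (@g_sym i x ix) (@g_pos i x ix)).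
  exact: (Ric_sym (@cod_o i) (@g_sym i) (@sf i) (@soliton_eq i) ix).
have := tr_Hess_Ric (@cod_o i) (@g_smooth i) (@g_sym i) (@g_unit i) (@sf i)
  (@soliton_eq i) (@scal_eq i) ix.
rewrite (HessE ix) l0 scale0r sub0r mulNmx mulNmx mulmxN raddfN /= => /eqP; rewrite oppr_eq0 => /eqP.
by rewrite !mulmxA.
Qed.

(** The transformation law of df is the chain rule, and J is invertible because
    both Gram matrices are. *)
Lemma chart_change i j p : dom (A i) p -> dom (A j) p -> exists J : 'M[R]_n,
  [/\ J \in unitmx,
      g i (fwd (A i) p) = J *m g j (fwd (A j) p) *m J^T,
      df_col (f_ i) (fwd (A i) p) = J *m df_col (f_ j) (fwd (A j) p) &
      forall r s, J r s =
        partial r (fun y => transition (A i) (A j) y 0 s) (fwd (A i) p)].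
Proof.
move=> ip jp; set x := fwd (A i) p; set y := fwd (A j) p.
have ix : cod (A i) x by exact: fwd_cod.
have jy : cod (A j) y by exact: fwd_cod.
have xp : bwd (A i) x = p by exact: fwdK.
have Txy : transition (A i) (A j) x = y by rewrite /transition xp.
have xT : transition_dom (A i) (A j) x by split; rewrite ?xp.
exists (transition_jacobian (A i) (A j) x).
have gE : g i x = transition_jacobian (A i) (A j) x *m g j y
    *m (transition_jacobian (A i) (A j) x)^T.
  by rewrite -Txy; exact: metric_compat.
split=> //; last by move=> r s; exact: mxE.
  have := g_unit ix; rewrite gE !unitmxE !det_mulmx !unitrM.
  by case/andP => /andP[].
apply/matrixP => r o; rewrite (ord1 o) df_colE mulE.
have near_x : \forall z \near x, dom (A j) (bwd (A i) z).
  have := bwd_continuous ix; apply.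
  by rewrite xp; apply: open_nbhs_nbhs; split=> //; exact: dom_open.
transitivity (partial r (fun z => f_ j (transition (A i) (A j) z)) x).
  apply: near_eq_partial; apply: filterS near_x => z jz /=.
  by rewrite /transition fwdK.
rewrite partial_comp; last 2 first.
- by move=> s; exact: (@atlas_smooth _ _ _ A i j s [::] _ xT).
- by rewrite Txy; exact: (smooth_differentiable (@sf j) jy).
by apply: eq_bigr => s _; rewrite df_colE Txy [transition_jacobian _ _ _ _ _]mxE.
Qed.

Let ch p := sval (cid (atlas_cover A p)).

Let chP p : dom (A (ch p)) p.
Proof. exact: (svalP (cid (atlas_cover A p))). Qed.

(** Squared length of grad f as a function on M.  It is computed in a chosen chart
    at p; by [grad_energyE] the choice is immaterial. *)
Definition grad_energy p : R :=
  energy (g (ch p)) (f_ (ch p)) (fwd (A (ch p)) p).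

Lemma grad_energyE i p : dom (A i) p ->
  grad_energy p = energy (g i) (f_ i) (fwd (A i) p).
Proof.
move=> ip; rewrite /grad_energy; have jp := chP p; move: (ch p) jp => j jp.
have [J [Ju gE wE _]] := chart_change ip jp.
have uj := g_unit (fwd_cod jp).
rewrite /energy /gradf gE wE; congr (_ 0 0).
rewrite trmx_mul !mulmxA; set w := df_col _ _.
have -> : invmx (J *m g j (fwd (A j) p) *m J^T) =
    invmx J^T *m invmx (g j (fwd (A j) p)) *m invmx J.
  have JTu : J^T \in unitmx by rewrite unitmx_tr.
  rewrite -[LHS]mulmx1; apply: (canLR (mulKmx _)).
    by rewrite !unitmx_mul Ju uj.
  by rewrite !mulmxA mulmxK // mulmxK // mulmxV.
have JTu : J^T \in unitmx by rewrite unitmx_tr.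
by rewrite !mulmxA (mulmxK JTu) (mulmxKV Ju).
Qed.

Section Geodesic.
Variable gamma : R -> M.
Hypothesis geo : is_geodesic g gamma.
Implicit Types (t : R).

Local Notation vel i := (velocity (A i) gamma).
Local Notation pos i := (fun s => fwd (A i) (gamma s)).

Let dom_near i t : dom (A i) (gamma t) -> \forall s \near t, dom (A i) (gamma s).
Proof.
by move=> it; apply: (geo.1 t); apply: open_nbhs_nbhs; split=> //; exact: dom_open.
Qed.

Let dpos i t : dom (A i) (gamma t) -> is_derive_mx t (pos i) (vel i t).
Proof.
move=> it a k; have [dk _ _] := geo.2 i t it k; rewrite (ord1 a) velocityE derive1E.
exact: derivableP.
Qed.

Let dvel i t : dom (A i) (gamma t) -> is_derive_mx t (vel i)
  (- (vel i t *m \sum_l vel i t 0 l *: Gam (g i) l (pos i t))).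
Proof.
move=> it a k; have [_ dk eqk] := geo.2 i t it k; rewrite (ord1 a).
have -> : (fun s => vel i s 0 k) = derive1 (curve_coord (A i) gamma k).
  by apply/funext => s; rewrite velocityE.
suff <- : derive1 (derive1 (curve_coord (A i) gamma k)) t =
    (- (vel i t *m \sum_l vel i t 0 l *: Gam (g i) l (pos i t))) 0 k.
  by rewrite derive1E; exact: derivableP.
apply/eqP; rewrite oppE -addr_eq0 -[X in _ == X]eqk; apply/eqP; congr (_ + _).
rewrite mulE exchange_big; apply: eq_bigr => b _; rewrite summxE mulr_sumr.
apply: eq_bigr => l _; rewrite scaleE GamE !velocityE.
by rewrite mulrC; congr (_ * _); rewrite mulrC.
Qed.

Lemma velocity_change i j t (J : 'M[R]_n) : dom (A i) (gamma t) ->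
  dom (A j) (gamma t) -> (forall r s, J r s =
    partial r (fun y => transition (A i) (A j) y 0 s) (pos i t)) ->
  vel j t = vel i t *m J.
Proof.
move=> it jt JE; apply/matrixP => o s; rewrite (ord1 o) velocityE derive1E mulE.
have ix := fwd_cod it; have xp := fwdK it.
have dT : differentiable (fun y => transition (A i) (A j) y 0 s) (pos i t).
  by apply: (@atlas_smooth _ _ _ A i j s [::]); split; rewrite ?xp.
have T_near : \forall u \near t,
    transition (A i) (A j) (fwd (A i) (gamma u)) 0 s = curve_coord (A j) gamma s u.
  by apply: filterS (dom_near it) => u iu; rewrite /transition fwdK.
have dTc := near_eq_is_derive T_near (chain_curve dT (fun k => dpos it 0 k)).
apply: (etrans (@derive_val _ _ _ _ _ _ _ dTc)).
by apply: eq_bigr => k _; rewrite JE mulrC.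
Qed.

Definition speed2 t : R :=
  (vel (ch (gamma t)) t *m g (ch (gamma t)) (pos (ch (gamma t)) t)
    *m (vel (ch (gamma t)) t)^T) 0 0.

Lemma speed2E i t : dom (A i) (gamma t) ->
  speed2 t = (vel i t *m g i (pos i t) *m (vel i t)^T) 0 0.
Proof.
move=> it; rewrite /speed2; have jt := chP (gamma t); move: (ch _) jt => j jt.
have [J [_ gE _ JE]] := chart_change it jt.
rewrite (velocity_change it jt JE) gE trmx_mul.
by rewrite !mulmxA.
Qed.

Definition df_along t : R := derive1 (f \o gamma) t.

Let f_near i t : dom (A i) (gamma t) ->
  \forall s \near t, f_ i (pos i s) = (f \o gamma) s.
Proof. by move=> /dom_near; apply: filterS => s ds /=; rewrite fwdK. Qed.

Lemma df_alongE i t : dom (A i) (gamma t) ->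
  df_along t = (vel i t *m df_col (f_ i) (pos i t)) 0 0.
Proof.
move=> it; have := is_derive_f_along (@sf i) (fwd_cod it) (dpos it).
move/(near_eq_is_derive (f_near it))=> h.
by rewrite /df_along derive1E (@derive_val _ _ _ _ _ _ _ h).
Qed.

Lemma is_derive_df_along_geodesic i t : dom (A i) (gamma t) ->
  is_derive t 1 df_along
    ((vel i t *m Hess (g i) (f_ i) (pos i t) *m (vel i t)^T) 0 0).
Proof.
move=> it; have := is_derive_df_along (@cod_o i) (@g_sym i) (@sf i) (fwd_cod it)
  (dpos it) (dvel it).
apply: near_eq_is_derive; apply: filterS (dom_near it) => s ds.
by rewrite (df_alongE ds).
Qed.

Lemma is_derive_speed2 t : is_derive t 1 speed2 0.
Proof.
have it := chP (gamma t); move: (ch _) it => i it.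
have := is_derive_speed_along (@cod_o i) (@g_smooth i) (@g_sym i) (@g_unit i)
  (fwd_cod it) (dpos it) (dvel it).
apply: near_eq_is_derive; apply: filterS (dom_near it) => s ds.
by rewrite (speed2E ds).
Qed.

Lemma is_derive_grad_energy t :
  is_derive t 1 (grad_energy \o gamma) (lambda * df_along t *+ 2).
Proof.
have it := chP (gamma t); move: (ch _) it => i it.
have := is_derive_energy_along (@cod_o i) (@g_smooth i) (@g_sym i) (@g_unit i) (@sf i)
  (@soliton_eq i) (@scal_eq i) (fwd_cod it) (dpos it).
rewrite -(df_alongE it).
apply: near_eq_is_derive; apply: filterS (dom_near it) => s ds /=.
by rewrite (grad_energyE ds).
Qed.

(** The defect of Cauchy-Schwarz for the velocity and the gradient. *)
Definition defect t : R := grad_energy (gamma t) * speed2 t - df_along t ^+ 2.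

Lemma defect_ge0 t : 0 <= defect t.
Proof.
have it := chP (gamma t); move: (ch _) it => i it; have ix := fwd_cod it.
rewrite /defect (grad_energyE it) (speed2E it) (df_alongE it) subr_ge0.
have := Cauchy_Schwarz (g_sym ix) (g_pos ix) (vel i t) (df_col (f_ i) (pos i t)).
by rewrite /energy /gradf mulmxA.
Qed.

Definition Ric_vel i t : R :=
  (vel i t *m Ric (g i) (pos i t) *m (vel i t)^T) 0 0.

Lemma is_derive_df_along_Ric i t : dom (A i) (gamma t) ->
  is_derive t 1 df_along (lambda * speed2 t - Ric_vel i t).
Proof.
move=> it; have := is_derive_df_along_geodesic it.
have -> // : (vel i t *m Hess (g i) (f_ i) (pos i t) *m (vel i t)^T) 0 0 =
  lambda * speed2 t - Ric_vel i t.
rewrite (speed2E it) /Ric_vel -scaleE -oppE -addE.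
rewrite (HessE (fwd_cod it)).
by rewrite mulmxBr mulmxBl -scalemxAr -scalemxAl.
Qed.

Lemma is_derive_defect i t : dom (A i) (gamma t) ->
  is_derive t 1 defect (df_along t * Ric_vel i t *+ 2).
Proof.
move=> it.
have d1 := is_deriveM (is_derive_grad_energy t) (is_derive_speed2 t).
have d2 := is_derive_df_along_Ric it.
have d3 := is_deriveM d2 d2.
have := is_deriveB d1 d3.
rewrite (_ : _ - _ = defect); last first.
  by apply/funext => s; rewrite /defect expr2.
move/is_derive_eq; apply.
by rewrite /GRing.scale/=; ring.
Qed.

Definition Ric_bound i x : R :=
  \sum_k \sum_l (1 + Ric (g i) x k l ^+ 2)
    * (invmx (g i x) k k + invmx (g i x) l l).

(** Only the component of the velocity orthogonal to the gradient contributes,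
    as Ric(grad f) = 0. *)
Lemma Ric_vel_bound i t : dom (A i) (gamma t) -> grad_energy (gamma t) != 0 ->
  `|Ric_vel i t| <= Ric_bound i (pos i t) * (defect t / grad_energy (gamma t)).
Proof.
move=> it; have ix := fwd_cod it.
rewrite /defect /Ric_vel (speed2E it) (df_alongE it) (grad_energyE it).
set w := df_col _ _; set v := vel i t; set x := fwd _ _ => q0.
have w0 : w != 0.
  by apply: contraNneq q0; rewrite /energy -/w => ->; rewrite trmx0 mul0mx mxE.
have RicT := Ric_sym (@cod_o i) (@g_sym i) (@sf i) (@soliton_eq i) ix.
have Rg := Ric_gradf (@cod_o i) (@g_smooth i) (@g_sym i) (@g_unit i) (@sf i)
  (@soliton_eq i) (@scal_eq i) ix.
rewrite -/x in RicT Rg; rewrite /gradf -/w in Rg.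
have gR : (invmx (g i x) *m w)^T *m Ric (g i) x = 0.
  by rewrite -[in LHS]RicT -trmx_mul Rg trmx0.
pose u := v - ((v *m w) 0 0 / energy (g i) (f_ i) x) *: (invmx (g i x) *m w)^T.
have Ru : u *m Ric (g i) x *m u^T = v *m Ric (g i) x *m v^T.
  rewrite /u mulmxBl -scalemxAl gR scaler0 subr0.
  rewrite trmxD trmxN mulmxDr mulmxN; set k := _ / _.
  have -> : (k *: (invmx (g i x) *m w)^T)^T = k *: (invmx (g i x) *m w).
    by apply/matrixP => a b; rewrite !mxE.
  by rewrite -scalemxAr -(mulmxA v _ (invmx _ *m _)) Rg mulmx0 scaler0 subr0.
have := quadratic_form_bound (Ric (g i) x) u (g_sym ix) (g_pos ix).
rewrite Ru => /le_trans; apply; rewrite /u /energy /gradf mulmxA -/w.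
rewrite (orthogonal_part (g_sym ix) (g_pos ix) v w0).
rewrite le_eqVlt; apply/orP; left; apply/eqP; congr (_ * _).
have := q0; rewrite /energy /gradf mulmxA -/w => q1.
by field.
Qed.

Let smooth_Ric_bound i : smooth_on (cod (A i)) (Ric_bound i).
Proof.
have oi := @cod_o i; have sR := smooth_Ric oi (@g_smooth i) (@g_sym i) (@g_unit i).
have sG := smooth_G oi (@g_smooth i) (@g_unit i).
apply: smooth_sum => // k; apply: smooth_sum => // l; apply: smoothM => //.
  apply: smoothD => //; first exact: smooth_cst.
  by apply: eq_smooth_on (smoothM oi (sR k l) (sR k l)) => // x _; rewrite expr2.
exact: smoothD.
Qed.

Let derive_continuous (h : R -> R) t d : is_derive t 1 h d -> {for t, continuous h}.
Proof.
move=> dh; apply: differentiable_continuous; apply/derivable1_diffP.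
exact: (@ex_derive _ _ _ _ _ _ _ dh).
Qed.

(** Twice the function [Lf] bounds the derivative of the defect relative to the
    defect itself, and [Lf] is continuous at t. *)
Lemma defect_growth t : (forall s, grad_energy (gamma s) != 0) ->
  exists L : R, \forall s \near t, `|'D_1 defect s| <= L * defect s.
Proof.
move=> q0; have it := chP (gamma t); move: (ch _) it => i it.
pose q s := grad_energy (gamma s).
pose Lf s : R := `|df_along s| * Ric_bound i (pos i s) * (q s)^-1.
have cL : {for t, continuous Lf}.
  have cdf := derive_continuous (is_derive_df_along_Ric it).
  have cq : {for t, continuous q} := derive_continuous (is_derive_grad_energy t).
  have cpos : {for t, continuous (pos i)}.
    by apply: continuous_comp; [exact: geo.1|exact: fwd_continuous].
  have cK : {for t, continuous (Ric_bound i \o pos i)}.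
    apply: continuous_comp => //; apply: differentiable_continuous.
    exact: smooth_differentiable (@smooth_Ric_bound i) (fwd_cod it).
  have cn : {for t, continuous (fun s => `|df_along s|)} by exact: cvg_norm.
  have cV : {for t, continuous (fun s => (q s)^-1)} by exact: (cvgV (q0 t) cq).
  exact: (cvgM (cvgM cn cK) cV).
exists ((Lf t + 1) *+ 2).
have Lnear : \forall s \near t, Lf s < Lf t + 1.
  have lt1 : Lf t < Lf t + 1 by rewrite ltrDl.
  exact: (@cvgr_lt R R (nbhs t) (nbhs_filter t) Lf (Lf t) cL _ lt1).
apply: filterS2 Lnear (dom_near it) => s Ls ds.
have zs := defect_ge0 s.
rewrite (@derive_val _ _ _ _ _ _ _ (is_derive_defect ds)).
rewrite normrMn normrM mulrnAl lerMn2r /=.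
apply: (@le_trans _ _ (Lf s * defect s)); last by rewrite ler_wpM2r // ltW.
rewrite /Lf -!mulrA ler_wpM2l // [_ * defect s]mulrC.
exact: Ric_vel_bound.
Qed.

Lemma defect_eq0 : (forall s, grad_energy (gamma s) != 0) -> defect 0 = 0 ->
  forall t, defect t = 0.
Proof.
move=> q0 z0; apply: (@gronwall_zero _ _ (fun t => 'D_1 defect t) _ _ defect_ge0 z0) => t.
  have it := chP (gamma t); have h := is_derive_defect it.
  by rewrite (@derive_val _ _ _ _ _ _ _ h).
exact: defect_growth.
Qed.

(** Once the defect vanishes, so does Ric(gamma', gamma'), and the second
    derivative of f along gamma is lambda |gamma'|^2. *)
Lemma df_along_affine : (forall s, grad_energy (gamma s) != 0) -> defect 0 = 0 ->
  forall t, df_along t = df_along 0 + lambda * speed2 0 * t.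
Proof.
move=> q0 z0 t.
have sE (s : R) : speed2 s = speed2 0 by exact: is_derive_0_is_cst is_derive_speed2.
have dd (s : R) : is_derive s 1 df_along (lambda * speed2 0).
  have is_ := chP (gamma s); have := is_derive_df_along_Ric is_.
  have := Ric_vel_bound is_ (q0 s); rewrite (defect_eq0 q0 z0 s) mul0r mulr0.
  by rewrite normr_le0 => /eqP ->; rewrite subr0 sE.
pose h (s : R) := df_along s - lambda * speed2 0 * s.
have hE : h t = h 0.
  apply: is_derive_0_is_cst => s.
  have lin : is_derive s 1 (fun s : R => lambda * speed2 0 * s) (lambda * speed2 0).
    rewrite (_ : (fun s => _) = (lambda * speed2 0) \*: id) //.
    by apply: is_derive_eq; rewrite [LHS]mulr1.
  by have := is_deriveB (dd s) lin; rewrite subrr.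
by move: hE; rewrite /h mulr0 subr0 => /eqP; rewrite subr_eq => /eqP.
Qed.

End Geodesic.

(** At the time - 1 / lambda the affine function of [df_along_affine] vanishes,
    while by [defect_eq0] its square is a product of two nonzero numbers. *)
Lemma exists_critical_point : complete_metric g -> lambda != 0 -> M ->
  exists p, grad_energy p = 0.
Proof.
move=> complete l0 p; apply: contrapT => nocrit.
have q0 p' : grad_energy p' != 0 by apply/eqP => e; apply: nocrit; exists p'.
have ip := chP p; move: (ch p) ip => i ip; set x := fwd (A i) p.
have ix : cod (A i) x by exact: fwd_cod.
have [gamma [geo g0 v0]] := complete i p (gradf (g i) (f_ i) x)^T ip.
have i0 : dom (A i) (gamma 0) by rewrite g0.
have vE : velocity (A i) gamma 0 = (gradf (g i) (f_ i) x)^T.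
  by apply/rowP => k; rewrite velocityE v0.
have sE : speed2 gamma 0 = grad_energy p.
  rewrite (speed2E geo i0) (grad_energyE ip) g0 vE -/x trmxK.
  rewrite /energy {1}/gradf trmx_mul trmx_inv (g_sym ix).
  by rewrite (mulmxKV (g_unit ix)).
have dE : df_along gamma 0 = grad_energy p.
  rewrite (df_alongE geo i0) (grad_energyE ip) g0 vE -/x /energy.
  by rewrite -[LHS]trE trmx_mul trmxK.
have z0 : defect gamma 0 = 0 by rewrite /defect g0 sE dE expr2 subrr.
have qg s : grad_energy (gamma s) != 0 by [].
have aff := df_along_affine geo qg z0 (- lambda^-1).
have d0 : df_along gamma (- lambda^-1) = 0.
  by rewrite aff sE dE mulrN mulrAC mulfV // mul1r subrr.
have := defect_eq0 geo qg z0 (- lambda^-1); rewrite /defect d0 expr0n subr0.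
have -> : speed2 gamma (- lambda^-1) = speed2 gamma 0.
  by apply: is_derive_0_is_cst; exact: is_derive_speed2.
by move/eqP; rewrite sE mulf_eq0 !(negPf (q0 _)).
Qed.

Lemma grad_energy_eq0 i p : dom (A i) p -> grad_energy p = 0 ->
  df_col (f_ i) (fwd (A i) p) = 0.
Proof.
move=> ip; rewrite (grad_energyE ip) /energy /gradf mulmxA => q0.
apply/eqP; apply: contraPT (invmx_pos (g_sym (fwd_cod ip)) (g_pos (fwd_cod ip))
  (w := df_col (f_ i) (fwd (A i) p))) => w0 /(_ w0).
by rewrite q0 ltxx.
Qed.

End Manifold.

Theorem theorem1 (R : realType) (n : nat) (M : topologicalType)
    (A : smooth_atlas R n M) (g : riemannian_metric A)
    (f : M -> R) (lambda c : R) :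
  manifold_space M ->
  gradient_ricci_soliton g f lambda ->
  scalar_curvature_constant g c ->
  exists k : nat, (k <= n)%N /\ c = k%:R * lambda.
Proof.
move=> [[p _] _ _ _] [complete sf sol] scal_cst.
have [l0|l0] := eqVneq lambda 0.
  exists 0%N; split=> //; rewrite mul0r; have [i ip] := atlas_cover A p.
  exact: (steady_scal0 sf sol scal_cst (fwd_cod ip) l0).
have [q q0] := exists_critical_point sf sol scal_cst complete l0 p.
have [i iq] := atlas_cover A q.
exact: (critical_point_value sf sol scal_cst l0 (fwd_cod iq) (grad_energy_eq0 sf iq q0)).
Qed.
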